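(* Let $X$ be a Banach space, $\mathcal{F}$ a regular thin family, $M\subseteq\mathbb{N}$ infinite, and let $(e_n)_{n\in\mathbb{N}}$ be a singular spreading model generated by the $\mathcal{F}$-subsequence $(x_s)_{s\in\mathcal{F}\upharpoonright M}$ in $X$. Let $e_n=e'_n+e$ be the natural decomposition of the singular spreading sequence $(e_n)_n$. Then there exist $x\in X$ and an infinite $L\subseteq M$ such that $\|x\|=\|e\|$ and, setting $x'_s=x_s-x$ for all $s\in\mathcal{F}\upharpoonright L$, the $\mathcal{F}$-subsequence $(x'_s)_{s\in\mathcal{F}\upharpoonright L}$ generates $(e'_n)_{n\in\mathbb{N}}$ as a unique $\mathcal{F}$-spreading model (that is, it generates $(e'_n)_n$, and any $\mathcal{F}$-spreading model generated by some $(x'_s)_{s\in\mathcal{F}\upharpoonright L'}$ with $L'\subseteq L$ infinite is isometric to $(e'_n)_n$).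
   Context: $\mathbb{N}=\{1,2,\dots\}$. For $M\subseteq\mathbb{N}$ infinite, $M(k)$ is its $k$-th element; for a finite set $s$, $s(k)$ is its $k$-th element; $t\sqsubseteq s$ means initial segment. For a family $\mathcal{F}$ of finite subsets of $\mathbb{N}$ let $\widehat{\mathcal{F}}=\{t:\exists s\in\mathcal{F},\ t\sqsubseteq s\}$ and $\mathcal{F}\upharpoonright M=\{s\in\mathcal{F}:s\subseteq M\}$. $\mathcal{F}$ is thin if no element is a proper initial segment of another. A family is regular if it is hereditary (closed under subsets), spreading (if $\{n_1<\dots<n_k\}$ is in it, $m_1<\dots<m_k$, $n_i\le m_i$ for all $i$, then $\{m_1,\dots,m_k\}$ is in it) and compact (its characteristic functions form a closed subset of $\{0,1\}^{\mathbb{N}}$). $\mathcal{F}$ is regular thin if it is thin and $\widehat{\mathcal{F}}$ is regular; regular thin families are assumed to contain a nonempty set. A tuple $(s_1,\dots,s_l)$ of nonempty finite subsets of $\mathbb{N}$ is plegma if $s_i(k)<s_j(k)$ whenever $i<j$ and $k\le\min(|s_i|,|s_j|)$, and $s_i(k)<s_j(k+1)$ for all $i,j$ and $k\le\min(|s_i|,|s_j|-1)$. An $\mathcal{F}$-subsequence $(x_s)_{s\in\mathcal{F}\upharpoonright M}$ in $X$ is a map $s\mapsto x_s$ from $\mathcal{F}\upharpoonright M$ to $X$. Let $(e_n)_n$ be a Hamel basis of an infinite-dimensional seminormed space with seminorm $\|\cdot\|_*$. $(x_s)_{s\in\mathcal{F}\upharpoonright M}$ generates $(e_n)_n$ as an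 ($\mathcal{F}$-)spreading model if there is a null sequence $(\delta_n)_n$ of positive reals such that $\big|\,\|\sum_{j=1}^k a_jx_{s_j}\|-\|\sum_{j=1}^k a_je_j\|_*\big|\le\delta_l$ for all $1\le k\le l$, all plegma $k$-tuples $(s_j)_{j=1}^k$ in $\mathcal{F}\upharpoonright M$ with $s_1(1)\ge M(l)$ and all $a_1,\dots,a_k\in[-1,1]$. Such $(e_n)_n$ is automatically spreading: $\|\sum_{j=1}^na_je_j\|_*=\|\sum_{j=1}^na_je_{k_j}\|_*$ for all $k_1<\dots<k_n$ and reals $a_j$. Two sequences $(u_n),(v_n)$ are isometric if $\|\sum_{j\le n} a_ju_j\|=\|\sum_{j\le n} a_jv_j\|$ for all $n$ and all reals $a_1,\dots,a_n$. A spreading sequence is trivial if the seminorm is not a norm on its span, and singular if it is nontrivial and is not a Schauder basis of the Banach space $E$ it generates (the completion of its span). A singular spreading sequence $(e_n)_n$ converges weakly in $E$ to some $e\ne0$; with $e'_n=e_n-e$, the representation $e_n=e'_n+e$ is called its natural decomposition. *)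

(* Defs.v *)
From HB Require Import structures.
From mathcomp Require Import all_boot all_order all_algebra finmap.
From mathcomp Require Import all_classical all_reals all_analysis.

Set Implicit Arguments.
Unset Strict Implicit.
Unset Printing Implicit Defensive.

Import Order.TTheory GRing.Theory Num.Theory.
Import numFieldNormedType.Exports.

Local Open Scope classical_set_scope.
Local Open Scope ring_scope.

(* Conventions.  The set N = {1, 2, ...} over which the families live is the
   set of positive elements of [nat].  Elements of sets are counted from 1, as
   in s(1), M(1).  The terms of a sequence e_1, e_2, ... of vectors are e 0,
   e 1, ..., and the members of a tuple s_1, ..., s_k are indexed by 'I_k. *)
Definition posN : set nat := [set n | (0 < n)%N].

Definition elts (s : {fset nat}) : seq nat := sort leq s.

(* s(k), for 1 <= k <= |s| *)
Definition kth (s : {fset nat}) (k : nat) : nat := nth 0%N (elts s) k.-1.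

(* M(k), for k >= 1 and M infinite: the m in M such that exactly k elements of
   M are <= m *)
Definition kth_set (M : set nat) (k : nat) : nat :=
  xget 0%N [set m | M m /\ count (fun n => `[< M n >]) (iota 0 m.+1) = k].

Definition initial_segment (t s : {fset nat}) : Prop := prefix (elts t) (elts s).

(* A family of finite subsets of N. *)
Definition family_on_N (F : set {fset nat}) : Prop :=
  forall s, F s -> forall n, n \in s -> posN n.

Definition hat (F : set {fset nat}) : set {fset nat} :=
  [set t | exists2 s, F s & initial_segment t s].

Definition restrict_family (F : set {fset nat}) (M : set nat) : set {fset nat} :=
  [set s | F s /\ forall n, n \in s -> M n].

Definition thin (F : set {fset nat}) : Prop :=
  forall s t, F s -> F t -> initial_segment t s -> t = s.

Definition hereditary (F : set {fset nat}) : Prop :=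
  forall s t, F s -> (t `<=` s)%fset -> F t.

Definition spreading_family (F : set {fset nat}) : Prop :=
  forall s t : {fset nat}, F s -> #|` t| = #|` s| ->
    (forall k, (1 <= k <= #|` s|)%N -> (kth s k <= kth t k)%N) -> F t.

(* [cantor_space] is the product of countably many copies of discrete bool. *)
Definition compact_family (F : set {fset nat}) : Prop :=
  closed [set chi : cantor_space |
    exists2 s, F s & chi = (fun n : nat => n \in s) :> (nat -> bool)].

Definition regular (F : set {fset nat}) : Prop :=
  [/\ hereditary F, spreading_family F & compact_family F].

Definition regular_thin (F : set {fset nat}) : Prop :=
  [/\ thin F, regular (hat F) & exists2 s, F s & s != fset0].

Definition plegma (l : nat) (s : 'I_l -> {fset nat}) : Prop :=
  [/\ forall i, s i != fset0,
      forall (i j : 'I_l) k, (i < j)%N ->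
        (1 <= k <= minn #|` s i| #|` s j|)%N -> (kth (s i) k < kth (s j) k)%N
    & forall (i j : 'I_l) k,
        (1 <= k <= minn #|` s i| #|` s j|.-1)%N ->
        (kth (s i) k < kth (s j) k.+1)%N].

Definition seminorm (R : realType) (V : lmodType R) (p : V -> R) : Prop :=
  (forall u v, p (u + v) <= p u + p v) /\ (forall a v, p (a *: v) = `|a| * p v).

Definition lin_indep (R : realType) (V : lmodType R) (e : nat -> V) : Prop :=
  forall (n : nat) (a : 'I_n -> R),
    \sum_(j < n) a j *: e j = 0 -> forall j, a j = 0.

Definition span_seq (R : realType) (V : lmodType R) (e : nat -> V) : set V :=
  [set v | exists n (a : 'I_n -> R), v = \sum_(j < n) a j *: e j].

(* The F-subsequence (x_s), s in F|M, generates (e_n) as a spreading model.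
   An F-subsequence is given by a total map x of which only the values on F|M
   are used.  The seminormed space of which (e_n) is a Hamel basis is the span
   of (e_n) inside an ambient seminormed space (V, p); it is infinite
   dimensional because (e_n) is linearly independent.  Plegma tuples are
   nonempty, and k.+1 is their length. *)
Definition generates (R : realType) (X : normedModType R)
    (F : set {fset nat}) (M : set nat) (x : {fset nat} -> X)
    (V : lmodType R) (p : V -> R) (e : nat -> V) : Prop :=
  [/\ seminorm p, lin_indep e &
    exists delta : nat -> R,
      [/\ forall l, 0 < delta l, delta @ \oo --> (0 : R) &
        forall (k l : nat) (s : 'I_k.+1 -> {fset nat}) (a : 'I_k.+1 -> R),
          (k.+1 <= l)%N -> plegma s ->
          (forall j, restrict_family F M (s j)) ->
          (kth_set M l <= kth (s ord0) 1)%N ->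
          (forall j, -1 <= a j <= 1) ->
          `| `|\sum_(j < k.+1) a j *: x (s j)| - p (\sum_(j < k.+1) a j *: e j) |
            <= delta l]].

Definition isometric (R : realType) (U V : lmodType R) (p : U -> R) (q : V -> R)
    (u : nat -> U) (v : nat -> V) : Prop :=
  forall (n : nat) (a : 'I_n -> R),
    p (\sum_(j < n) a j *: u j) = q (\sum_(j < n) a j *: v j).

Definition spreading (R : realType) (V : lmodType R) (p : V -> R)
    (e : nat -> V) : Prop :=
  forall (n : nat) (k : 'I_n -> nat) (a : 'I_n -> R),
    (forall i j : 'I_n, (i < j)%N -> (k i < k j)%N) ->
    p (\sum_(j < n) a j *: e j) = p (\sum_(j < n) a j *: e (k j)).

Definition trivial_seq (R : realType) (V : lmodType R) (p : V -> R)
    (e : nat -> V) : Prop :=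
  ~ (forall v, span_seq e v -> p v = 0 -> v = 0).

(* [E], with the linear map [iota], is a completion of the span of (e_n)
   seminormed by p. *)
Definition completion_of_span (R : realType) (V : lmodType R) (p : V -> R)
    (e : nat -> V) (E : completeNormedModType R) (iota : {linear V -> E}) : Prop :=
  (forall v, span_seq e v -> `|iota v| = p v) /\ dense (iota @` span_seq e).

Definition schauder_basis (R : realType) (E : completeNormedModType R)
    (u : nat -> E) : Prop :=
  forall v : E, exists! a : nat -> R,
    (fun n => \sum_(j < n) a j *: u j) @ \oo --> v.

Definition singular_spreading (R : realType) (V : lmodType R) (p : V -> R)
    (e : nat -> V) (E : completeNormedModType R) (iota : {linear V -> E}) : Prop :=
  [/\ spreading p e, ~ trivial_seq p e & ~ schauder_basis (iota \o e)].

Definition weakly_converges (R : realType) (E : normedModType R)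
    (u : nat -> E) (v : E) : Prop :=
  forall f : {scalar E}, continuous f -> (fun n => f (u n)) @ \oo --> f v.

Definition natural_decomposition (R : realType) (E : normedModType R)
    (u u' : nat -> E) (v : E) : Prop :=
  [/\ weakly_converges u v, v <> 0 & forall n, u' n = u n - v].

(* Main.v *)
(* Write [u n] for the image of [e_ n] in [E].  By Hahn-Banach the weak limit [e]
   is approximated by combinations of arbitrarily late terms of [u], so by
   spreading a single choice of weights [lam] makes [\sum_j lam j *: u (k j)]
   close to [e] for all increasing [k].  Hence, along plegma tuples [t] starting
   late enough, the vectors [\sum_j lam j *: x_ (t j)] of two tuples whose
   concatenation is plegma are close to each other.  On a sparse [L] every plegma
   tuple can be extended by interleaved elements of [F], and moved through a
   chain of such concatenations to a canonical tuple; the errors along the chain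
   telescope, so these vectors converge to one [x], uniformly in the tuple.
   Appending to a tuple [s] a tuple with such a combination near [x] compares
   [\sum_j a j *: (x_ (s j) - x)] with [\sum_j a j *: (u j - e)]. *)

Require Import Defs.
From HB Require Import structures.
From mathcomp Require Import all_boot all_order all_algebra finmap.
From mathcomp Require Import all_classical all_reals all_analysis.
From mathcomp Require Import ring lra zify.
Import Order.TTheory GRing.Theory Num.Theory.
Import numFieldNormedType.Exports.
Local Open Scope classical_set_scope.
Local Open Scope ring_scope.

Set Implicit Arguments.
Unset Strict Implicit.
Unset Printing Implicit Defensive.

(** * The Hahn-Banach theorem for a seminorm *)

(* A linear functional on a subspace is encoded by its graph [G]; domination by
   [p] makes [G] single-valued, so this need not be assumed. *)
Definition dominated_graph (R : realType) (V : lmodType R) (p : V -> R)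
    (G : set (V * R)) : Prop :=
  (forall a u r v s, G (u, r) -> G (v, s) -> G (a *: u + v, a * r + s)) /\
  forall v r, G (v, r) -> r <= p v.

(** The value [c] at [v] has to lie above every [s - p (y - v)] and below every [p (y' + v) - s'].
    Subadditivity puts each lower bound below each upper one, so the supremum of the lower bounds
    serves; homogeneity reduces a general multiple of [v] to [v] and [- v]. *)
Lemma dominated_graph_extend (R : realType) (V : lmodType R) (p : V -> R)
    (G : set (V * R)) (v : V) :
  seminorm p -> dominated_graph p G -> G !=set0 ->
  exists c, dominated_graph p [set yr | exists a y s,
    G (y, s) /\ yr = (y + a *: v, s + a * c)].
Proof.
move=> [pD pZ] [Gl Gp] [[y0 s0] G0].
pose B : set R := [set t | exists y s, G (y, s) /\ t = s - p (y - v)].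
have B_ub y' s' : G (y', s') -> ubound B (p (y' + v) - s').
  move=> G' _ [y [s [Gys ->]]].
  have /Gp : G (1 *: y + y', 1 * s + s') by exact: Gl.
  rewrite scale1r mul1r => h; have := pD (y - v) (y' + v).
  by rewrite addrACA addNr addr0; lra.
have supB : has_sup B.
  split; first by exists (s0 - p (y0 - v)); exists y0, s0.
  by exists (p (y0 + v) - s0); exact: B_ub.
have G00 : G (0, 0).
  have := Gl (-1) _ _ _ _ G0 G0.
  by rewrite scaleN1r addNr mulN1r addNr.
have GZ a y s : G (y, s) -> G (a *: y, a * s).
  by move=> /(Gl a) /(_ G00); rewrite !addr0.
exists (sup B); split.
  move=> a u r w t [b [y [s [Gys [-> ->]]]]] [b' [y' [s' [Gys' [-> ->]]]]].
  exists (a * b + b'), (a *: y + y'), (a * s + s'); split; first exact: Gl.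
  congr pair; last by ring.
  by rewrite scalerDr scalerDl scalerA addrACA.
move=> w r [a [y [s [Gys [-> ->]]]]].
have [a0|a0|->] := ltgtP a 0; last by rewrite scale0r addr0 mul0r addr0; exact: Gp.
- have /(GZ (- a)^-1) Gb := Gys.
  have : (- a)^-1 * s - p ((- a)^-1 *: y - v) <= sup B.
    by apply: sup_upper_bound => //; exists ((- a)^-1 *: y), ((- a)^-1 * s).
  have -> : y + a *: v = (- a) *: ((- a)^-1 *: y - v).
    by rewrite scalerBr scalerA divff ?oppr_eq0 ?lt_eqF// scale1r scaleNr opprK.
  rewrite pZ (ger0_norm (_ : 0 <= - a)); last by lra.
  move=> /(ler_wpM2l (_ : 0 <= - a)) h.
  have /h : 0 <= - a by lra.
  rewrite mulrBr mulrA divff ?oppr_eq0 ?lt_eqF// mul1r; lra.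
- have /(GZ a^-1) Gb := Gys.
  have : sup B <= p (a^-1 *: y + v) - a^-1 * s.
    by apply: ge_sup; [case: supB|exact: B_ub].
  have -> : y + a *: v = a *: (a^-1 *: y + v).
    by rewrite scalerDr scalerA divff ?gt_eqF// scale1r.
  rewrite pZ (ger0_norm (ltW a0)) => /(ler_wpM2l (ltW a0)).
  rewrite mulrBr mulrA divff ?gt_eqF// mul1r; lra.
Qed.

Lemma hahn_banach (R : realType) (V : lmodType R) (p : V -> R)
    (G0 : set (V * R)) :
  seminorm p -> dominated_graph p G0 -> G0 !=set0 ->
  exists f : {scalar V},
    (forall v r, G0 (v, r) -> f v = r) /\ forall v, `|f v| <= p v.
Proof.
move=> sp domG0 G0n0.
(* The inclusion is asked only of nonempty [A]: Zorn's lemma also meets the empty chain, whose union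
   is empty and must satisfy [P]. *)
pose P (A : set (V * R)) := dominated_graph p A /\ (A !=set0 -> G0 `<=` A).
have [|A [[domA A0] maxA]] := @Zorn_bigcup _ P.
  move=> C CP Ctot; split; first split.
  - move=> a u r v s [X CX Xu] [Y CY Yv].
    by case: (Ctot X Y CX CY) => [XY|YX];
      [exists Y|exists X] => //; [case: (CP Y CY)|case: (CP X CX)] => -[+ _ _];
      apply => //; [exact: XY|exact: YX].
  - by move=> v r [X CX]; case: (CP X CX) => -[_ + _]; apply.
  - move=> [z [X CX Xz]] t /(_ : G0 `<=` X) h; exists X => //; apply: h => //.
    by case: (CP X CX) => _; apply; exists z.
have An0 : A !=set0.
  have [A_0|/set0P//] := eqVneq A set0; exfalso.
  apply: (maxA G0); last by split=> // _.
  by rewrite A_0; split => // h; case: G0n0 => z /h.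
have tot v : exists r, A (v, r).
  have [c domB] := dominated_graph_extend v sp domA An0.
  set B := [set _ | _] in domB.
  have AB : A `<=` B.
    by move=> [y s] Ays; exists 0, y, s; rewrite scale0r mul0r !addr0.
  have A00 : A (0, 0).
    case: An0 => -[y s] Ays; have [Al _] := domA; have := Al (-1) _ _ _ _ Ays Ays.
    by rewrite scaleN1r addNr mulN1r addNr.
  exists c; apply: contrapT => nA; apply: (maxA B); last first.
    by split => // _; apply: subset_trans AB; exact: A0.
  split => // /(_ (v, c)) BA; apply/nA/BA; exists 1, 0, 0.
  by rewrite scale1r mul1r !add0r.
have [f fP] := choice tot.
have Afun v r : A (v, r) -> f v = r.
  move=> Avr; case: domA => Al Ap.
  have h r1 r2 : A (v, r1) -> A (v, r2) -> r1 <= r2.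
    move=> A1 A2; have := Ap _ _ (Al (-1) _ _ _ _ A2 A1).
    rewrite scaleN1r addNr mulN1r -(scale0r (0 : V)).
    by case: sp => _ ->; rewrite normr0 mul0r; lra.
  by apply/eqP; rewrite eq_le !h.
have flin : scalar f.
  by move=> a u v; apply: Afun; case: domA => + _; apply.
pose fM := GRing.isLinear.Build R V R *%R f flin.
pose g : {scalar V} := HB.pack f fM.
exists g; split => [v r /(A0 An0)/Afun //|v].
have fp u : f u <= p u by case: domA => _; apply.
rewrite ler_norml fp andbT lerNl.
have -> : - f v = f (- v) by rewrite -[f]/(g : V -> R) linearN.
have -> : p v = p (- v) by case: sp => _ pZ; rewrite -scaleN1r pZ normrN1 mul1r.
exact: fp.
Qed.

(** * Concatenation, linear spans and spreading sequences *)

(** A tuple of length [n] is coded by a total function of which only the first [n] values matter, so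
    concatenation needs no casts between ordinals. *)
Definition cat_fun (T : Type) (n : nat) (f g : nat -> T) (j : nat) : T :=
  if (j < n)%N then f j else g (j - n)%N.

Lemma cat_funl (T : Type) n (f g : nat -> T) j : (j < n)%N -> cat_fun n f g j = f j.
Proof. by rewrite /cat_fun => ->. Qed.

Lemma cat_funr (T : Type) n (f g : nat -> T) j : cat_fun n f g (n + j) = g j.
Proof. by rewrite /cat_fun ltnNge leq_addr addKn. Qed.

Lemma sum_cat_fun (R : pzRingType) (V : lmodType R) n m (b d : nat -> R)
    (w z : nat -> V) :
  \sum_(j < n + m) cat_fun n b d j *: cat_fun n w z j =
  \sum_(j < n) b j *: w j + \sum_(j < m) d j *: z j.
Proof.
rewrite big_split_ord /=; congr (_ + _); apply: eq_bigr => i _; last by rewrite !cat_funr.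
by rewrite !cat_funl.
Qed.

Lemma ord_fun_extend (T : Type) (x0 : T) n (a : 'I_n -> T) :
  exists b : nat -> T, forall i : 'I_n, b i = a i.
Proof. by exists (fun j => oapp a x0 (insub j)) => i; rewrite valK. Qed.

Definition increasing_below (n : nat) (k : nat -> nat) :=
  forall i j, (i < j < n)%N -> (k i < k j)%N.

Lemma increasing_below_cat_fun n m (k l : nat -> nat) :
  increasing_below n k -> increasing_below m l ->
  (forall i j, (i < n)%N -> (k i < l j)%N) -> increasing_below (n + m) (cat_fun n k l).
Proof.
move=> ik il kl i j /andP[ij jnm]; rewrite /cat_fun.
have [jn|nj] := ltnP j n; first by rewrite (ltn_trans ij jn) ik// ij.
have [iN|Ni] := ltnP i n; first exact: kl.
by apply: il; lia.
Qed.

Lemma increasing_below_addl N n : increasing_below n (addn N).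
Proof. by move=> i j /andP[ij _]; rewrite ltn_add2l. Qed.

Lemma increasing_below_ub n (k : nat -> nat) :
  exists N, (n <= N)%N /\ forall i, (i < n)%N -> (k i < N)%N.
Proof.
elim: n => [|n [N [nN kN]]]; first by exists 0%N.
exists (N + k n).+1; split; first lia.
by move=> i; rewrite ltnS leq_eqVlt => /predU1P[->|/kN]; lia.
Qed.

(** This is [spreading] for the norm of [E], restated with total functions so that it applies to
    [cat_fun]. *)
Definition spreading_norm (R : realType) (E : normedModType R) (u : nat -> E) :=
  forall n k (b : nat -> R), increasing_below n k ->
    `|\sum_(j < n) b j *: u (k j)| = `|\sum_(j < n) b j *: u j|.

Lemma span_seqP (R : realType) (V : lmodType R) (e : nat -> V) v :
  span_seq e v <-> exists n (b : nat -> R), v = \sum_(j < n) b j *: e j.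
Proof.
split=> [[n [a ->]]|[n [b ->]]]; last by exists n, (fun j => b j).
have [b ab] := ord_fun_extend 0 a; exists n, b.
by apply: eq_bigr => i _; rewrite ab.
Qed.

Lemma sum_widen (R : pzRingType) (V : lmodType R) n m (b : nat -> R) (w : nat -> V) :
  (n <= m)%N ->
  \sum_(j < n) b j *: w j = \sum_(j < m) (if (j < n)%N then b j else 0) *: w j.
Proof.
move=> nm; rewrite (big_ord_widen m (fun j => b j *: w j) nm) big_mkcond.
by apply: eq_bigr => i _; case: ifP; rewrite ?scale0r.
Qed.

Lemma span_seq_comb (R : realType) (V : lmodType R) (e : nat -> V) (a : R) v w :
  span_seq e v -> span_seq e w -> span_seq e (a *: v + w).
Proof.
move=> /span_seqP[n [b ->]] /span_seqP[m [d ->]]; apply/span_seqP.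
exists (n + m)%N, (fun j => a * (if (j < n)%N then b j else 0) +
  (if (j < m)%N then d j else 0)).
rewrite (sum_widen b e (leq_addr m n)) (sum_widen d e (leq_addl n m)).
rewrite scaler_sumr -big_split; apply: eq_bigr => j _ /=.
by rewrite scalerDl scalerA.
Qed.

Lemma span_seq0 (R : realType) (V : lmodType R) (e : nat -> V) : span_seq e 0.
Proof. by apply/span_seqP; exists 0%N, (fun=> 0); rewrite big_ord0. Qed.

Lemma span_seq_gen (R : realType) (V : lmodType R) (e : nat -> V) j : span_seq e (e j).
Proof.
apply/span_seqP; exists j.+1, (fun i => (i == j)%:R).
rewrite big_ord_recr /= eqxx scale1r big1 ?add0r// => i _.
by rewrite ltn_eqF// scale0r.
Qed.

Lemma span_seq_sum (R : realType) (V : lmodType R) (e : nat -> V) n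
    (b : 'I_n -> R) (k : 'I_n -> nat) :
  span_seq e (\sum_(j < n) b j *: e (k j)).
Proof.
elim/big_ind: _ => [|v w vs ws|j _]; first exact: span_seq0.
  by rewrite -[v]scale1r; exact: span_seq_comb.
by rewrite -[X in span_seq _ X]addr0; apply: span_seq_comb; [exact: span_seq_gen|exact: span_seq0].
Qed.

Lemma completion_spreading_norm (R : realType) (V : lmodType R) (p : V -> R)
    (e : nat -> V) (E : completeNormedModType R) (iota : {linear V -> E}) :
  completion_of_span p e iota -> spreading p e -> spreading_norm (iota \o e).
Proof.
move=> [iotaE _] spr n k b kinc.
have sumE l : \sum_(j < n) b j *: (iota \o e) (l j) =
    iota (\sum_(j < n) b j *: e (l j)).
  by rewrite linear_sum; apply: eq_bigr => j _; rewrite linearZ.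
rewrite (sumE k) (sumE id) !iotaE; try exact: (span_seq_sum _ (fun j => b j)).
rewrite (spr n (fun j => k j) (fun j => b j))// => i j ij; apply: kinc.
by rewrite ij ltn_ord.
Qed.

(** Nontriviality makes [p] a norm on the span, and [iota] preserves it there, so [iota] is
    injective on the span. *)
Lemma completion_lin_indep (R : realType) (V : lmodType R) (p : V -> R)
    (e : nat -> V) (E : completeNormedModType R) (iota : {linear V -> E}) :
  completion_of_span p e iota -> ~ trivial_seq p e -> lin_indep e ->
  lin_indep (iota \o e).
Proof.
move=> [iotaE _] /contrapT ntr ind n a sum0; apply: ind.
have es := span_seq_sum e a (@nat_of_ord n).
apply: ntr => //; rewrite -iotaE//.
suff -> : iota (\sum_(j < n) a j *: e j) = 0 by rewrite normr0.
by rewrite -sum0 linear_sum; apply: eq_bigr => j _; rewrite linearZ.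
Qed.

Lemma seminorm_norm (R : realType) (E : normedModType R) :
  seminorm (fun v : E => `|v|).
Proof. by split=> [u v|a v]; [exact: ler_normD|exact: normrZ]. Qed.

(** * Weak limits of spreading sequences *)

(** Otherwise [v] has distance at least [eta] from the span of the tail. Then sending [y + c *: v]
    to [c * eta] is dominated by the norm, and its extension vanishes on the tail but equals [eta]
    at [v], against weak convergence. *)
Lemma weak_limit_tail_span (R : realType) (E : normedModType R) (u : nat -> E) (v : E) :
  weakly_converges u v -> forall N eta, 0 < eta ->
  exists m (b : nat -> R), `|\sum_(j < m) b j *: u (N + j)%N - v| <= eta.
Proof.
move=> uv N eta eta0; apply: contrapT => far.
pose w j := u (N + j)%N.
have sep y : span_seq w y -> eta <= `|y - v|.
  move=> /span_seqP[m [b ->]]; rewrite leNgt; apply/negP => lt_eta.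
  by apply: far; exists m, b; exact: ltW.
pose G : set (E * R) := [set yr | exists y c,
  span_seq w y /\ yr = (y + c *: v, c * eta)].
have Gdom : dominated_graph (fun v : E => `|v|) G.
  split.
    move=> a x r x' r' [y [c [ys [-> ->]]]] [y' [c' [ys' [-> ->]]]].
    exists (a *: y + y'), (a * c + c'); split; first exact: span_seq_comb.
    by congr pair; [rewrite scalerDr scalerDl scalerA addrACA|ring].
  move=> x r [y [c [ys [-> ->]]]].
  have [->|c0] := eqVneq c 0; first by rewrite mul0r normr_ge0.
  have -> : y + c *: v = (- c) *: ((- c)^-1 *: y - v).
    by rewrite scalerBr scalerA divff ?oppr_eq0// scale1r scaleNr opprK.
  rewrite normrZ normrN (le_trans (_ : _ <= `|c| * eta))//.
    by rewrite ler_wpM2r ?ler_norm// ltW.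
  rewrite ler_wpM2l// sep// -[_ *: y]addr0.
  by apply: span_seq_comb => //; exact: span_seq0.
have [|f [fG fle]] := hahn_banach (seminorm_norm E) Gdom.
  by exists (0 + 1 *: v, 1 * eta); exists 0, 1; split => //; exact: span_seq0.
have fc : continuous f.
  move=> x; apply/(@cvgrPdist_lt _ _ _ (nbhs x)) => r r0; apply/nbhs_ballP.
  exists r => //= z; rewrite -ball_normE /= => xz.
  by rewrite -linearB (le_lt_trans (fle _)).
have fv : f v = eta.
  apply: fG; exists 0, 1; split; first exact: span_seq0.
  by rewrite scale1r add0r mul1r.
have fw j : f (w j) = 0.
  apply: fG; exists (w j), 0; split; first exact: span_seq_gen.
  by rewrite scale0r addr0 mul0r.
have /cvgrPdist_lt /(_ eta eta0) [N' _ N'P] := uv f fc.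
have := N'P (N + N')%N (leq_addl _ _).
by rewrite /= -/(w N') fw fv subr0 gtr0_norm// ltxx.
Qed.

(* The weak limit is approximated by combinations of terms beyond the indices
   in play, and those do not see which indices are in play. *)
Lemma spreading_norm_weak_limit (R : realType) (E : normedModType R)
    (u : nat -> E) (v : E) :
  spreading_norm u -> weakly_converges u v ->
  forall n k (b : nat -> R) c, increasing_below n k ->
  `|\sum_(j < n) b j *: u (k j) + c *: v| = `|\sum_(j < n) b j *: u j + c *: v|.
Proof.
move=> spr uv n k b c kinc.
apply/eqP; rewrite -subr_eq0 -normr_le0; apply/ler_addgt0Pr => eps eps0.
(* Replacing [v] by a vector within [eta] costs [|c| * eta], at most [eps / 2]; the summand 1 keeps
   the quotient defined for [c = 0]. *)
rewrite add0r; pose eta := eps / (2 * (1 + `|c|)).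
have c0 := normr_ge0 c.
have eta0 : 0 < eta by rewrite divr_gt0//; lra.
(* [N] exceeds both the indices [k i] and the indices below [n], so the same tail combination [T]
   can be appended to either sum. *)
have [N [nN kN]] := increasing_below_ub n k.
have [m [d dv]] := weak_limit_tail_span uv N eta0.
set T := \sum_(j < m) _ in dv.
have catE (k' : nat -> nat) : \sum_(j < n) b j *: u (k' j) + c *: T =
    \sum_(j < n + m) cat_fun n b (fun j => c * d j) j *: u (cat_fun n k' (addn N) j).
  rewrite scaler_sumr; under [X in _ + X]eq_bigr do rewrite scalerA.
  rewrite -(sum_cat_fun n m b (fun j => c * d j) (fun j => u (k' j)) (fun j => u (N + j)%N)).
  by apply: eq_bigr => j _; rewrite /cat_fun; case: ifP.
have normE : `|\sum_(j < n) b j *: u (k j) + c *: T| =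
    `|\sum_(j < n) b j *: u j + c *: T|.
  rewrite (catE k) (catE id) !spr//; apply: increasing_below_cat_fun => //.
  - by move=> i j /andP[].
  - exact: increasing_below_addl.
  - by move=> i j iN; lia.
  - exact: increasing_below_addl.
  - by move=> i j /kN; lia.
have close A : `| `|A + c *: T| - `|A + c *: v| | <= eps / 2.
  rewrite (le_trans (ler_dist_dist _ _))// opprD addrACA subrr add0r -scalerBr normrZ.
  apply: le_trans (ler_wpM2l c0 dv) _.
  by rewrite /eta mulrA ler_pdivrMr; nra.
have := close (\sum_(j < n) b j *: u (k j)); rewrite normE.
have := close (\sum_(j < n) b j *: u j).
rewrite !ler_norml; lra.
Qed.

(** By [spreading_norm_weak_limit] with [c = -1], the distance of the combination to [v] is the same
    for all increasing indices. *)
Lemma weak_limit_weights (R : realType) (E : normedModType R) (u : nat -> E) (v : E) :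
  spreading_norm u -> weakly_converges u v -> forall kappa, 0 < kappa ->
  exists m (b : nat -> R), forall k, increasing_below m k ->
    `|\sum_(j < m) b j *: u (k j) - v| <= kappa.
Proof.
move=> spr uv kappa kappa0.
have [m [b bv]] := weak_limit_tail_span uv 0 kappa0; exists m, b => k kinc.
by rewrite -scaleN1r (spreading_norm_weak_limit spr uv)// scaleN1r.
Qed.

(** A relation says that a combination of the first [n] terms of [u] equals a multiple of [v]. The
    same combination of the next [n] terms then equals the same multiple, and the difference is a
    relation among distinct terms of [u]. *)
Lemma weakly_null_part_lin_indep (R : realType) (E : normedModType R)
    (u : nat -> E) (v : E) :
  spreading_norm u -> weakly_converges u v -> lin_indep u ->
  lin_indep (fun n => u n - v).
Proof.
move=> spr uv ind n a; have [b ab] := ord_fun_extend 0 a.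
under eq_bigr do rewrite -ab scalerBr.
rewrite sumrB -scaler_suml -scaleNr => sum0 j.
have sumn : \sum_(j < n) b j *: u (n + j)%N + - (\sum_(j < n) b j) *: v = 0.
  apply/normr0_eq0; rewrite (spreading_norm_weak_limit spr uv) ?sum0 ?normr0//.
  exact: increasing_below_addl.
have /ind /(_ (lshift n j)) : \sum_(j < n + n) cat_fun n b (fun j => - b j) j *: u j = 0.
  have -> : \sum_(j < n + n) cat_fun n b (fun j => - b j) j *: u j =
     \sum_(j < n + n) cat_fun n b (fun j => - b j) j *: cat_fun n u (fun j => u (n + j)%N) j.
    apply: eq_bigr => i _; congr (_ *: _); rewrite /cat_fun; case: ltnP => // ni.
    by rewrite subnKC.
  rewrite sum_cat_fun; under [X in _ + X]eq_bigr do rewrite scaleNr.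
  rewrite sumrN; apply/eqP; rewrite subr_eq0; apply/eqP.
  by apply: (addIr (- (\sum_(j < n) b j) *: v)); rewrite sum0 sumn.
by rewrite cat_funl/= ?ltn_ord// -ab.
Qed.

(** * One-point extensions in a regular thin family *)

Lemma elts_ltn_sorted s : sorted ltn (elts s).
Proof. by rewrite ltn_sorted_uniq_leq sort_uniq fset_uniq sort_sorted. Qed.

Lemma mem_elts s n : (n \in elts s) = (n \in s).
Proof. by rewrite mem_sort. Qed.

Lemma size_elts s : size (elts s) = #|` s|.
Proof. by rewrite size_sort. Qed.

Lemma eltsK s : [fset n in elts s]%fset = s.
Proof. by apply/fsetP => n; rewrite !inE mem_elts. Qed.

Lemma elts_fset l : sorted ltn l -> elts [fset n in l]%fset = l.
Proof.
move=> sl; apply: (irr_sorted_eq ltn_trans ltnn) => //; first exact: elts_ltn_sorted.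
by move=> n; rewrite mem_elts !inE.
Qed.

Lemma elts_incr s i j : (i < j < #|` s|)%N ->
  (nth 0%N (elts s) i < nth 0%N (elts s) j)%N.
Proof.
move=> /andP[ij js]; apply: (sorted_ltn_nth ltn_trans) => //.
- exact: elts_ltn_sorted.
- by rewrite inE size_elts; exact: ltn_trans js.
- by rewrite inE size_elts.
Qed.

(** Along a sequence with gaps between consecutive terms, adding the next term to an initial segment
    in [hat F] cannot leave [hat F] until a member of [F] has been reached. *)
Definition gap (F : set {fset nat}) (a b : nat) : Prop :=
  (a < b)%N /\ forall t b', (forall n, n \in t -> (n <= a)%N) ->
    hat F t -> ~ F t -> (b <= b')%N -> hat F (b' |` t)%fset.

Lemma gap_weaken F a b a' b' : gap F a b -> (a' <= a)%N -> (b <= b')%N ->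
  gap F a' b'.
Proof.
move=> [ab gapF] aa bb; split; first exact: leq_ltn_trans aa (leq_trans ab bb).
move=> t c ta ht nt bc; apply: gapF => //; last exact: leq_trans bc.
by move=> n /ta na; exact: leq_trans aa.
Qed.

Lemma elts_rcons (t : {fset nat}) b : (forall n, n \in t -> (n < b)%N) ->
  elts (b |` t)%fset = rcons (elts t) b.
Proof.
move=> tb; rewrite -[RHS]elts_fset.
  by congr elts; apply/fsetP => n; rewrite !inE mem_rcons inE mem_elts.
case E : (elts t) => [//|a l]; rewrite rcons_cons /= rcons_path.
rewrite -[path _ _ _]/(sorted ltn (a :: l)) -E elts_ltn_sorted /=.
by apply: tb; rewrite -mem_elts E mem_last.
Qed.

(** A [t] in [hat F] but not in [F] is a proper initial segment of some [s] in [F]. If [m] is the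
    next element of [s], spreading allows [m] to be replaced by any larger [b]. *)
Lemma hat_extend F a t : regular_thin F -> exists b0, forall b, (b0 <= b)%N ->
  (a < b)%N -> (forall n, n \in t -> (n <= a)%N) -> hat F t -> ~ F t ->
  hat F (b |` t)%fset.
Proof.
move=> [thinF [_ spF _] _].
have [[ht nt]|/not_andP h] := pselect (hat F t /\ ~ F t); last first.
  by exists 0%N => b _ _ _ ht nt; case: h.
have [s Fs /prefixP[l sl]] := ht.
case: l sl => [|m l] sl.
  by exfalso; apply: nt; rewrite -[t]eltsK -[elts t]cats0 -sl eltsK.
exists m => b mb ab ta _ _.
have tl : sorted ltn (rcons (elts t) m).
  have := elts_ltn_sorted s; rewrite sl -cat_rcons.
  by case: (rcons _ _) => //= ? ?; rewrite cat_path => /andP[].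
have et : elts [fset n in rcons (elts t) m]%fset = rcons (elts t) m by exact: elts_fset.
have eb : elts (b |` t)%fset = rcons (elts t) b.
  by apply: elts_rcons => n /ta na; exact: leq_ltn_trans na ab.
apply: (spF [fset n in rcons (elts t) m]%fset).
- exists s => //; rewrite /initial_segment et sl -cat_rcons; exact: prefix_prefix.
- by rewrite -!size_elts eb et !size_rcons.
- rewrite -size_elts et size_rcons => k /andP[k0 kt].
  rewrite /kth et eb !nth_rcons; case: ltngtP => //.
Qed.

Lemma uniform_bound (T : eqType) (P : T -> nat -> Prop) (l : seq T) :
  (forall t, exists b0, forall b, (b0 <= b)%N -> P t b) ->
  exists b0, forall t b, t \in l -> (b0 <= b)%N -> P t b.
Proof.
move=> h; elim: l => [|t l [b0 IH]]; first by exists 0%N.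
have [b1 Pt] := h t; exists (maxn b0 b1) => t' b.
rewrite inE geq_max => /predU1P[->|t'l] /andP[? ?]; [exact: Pt|exact: IH].
Qed.

(** Only the finitely many subsets of [{0, ..., a}] matter, so their thresholds have a common
    bound. *)
Lemma gap_exists F a : regular_thin F -> exists b, gap F a b.
Proof.
move=> rF.
have [b0 hb] := uniform_bound (fpowerset [fset n in iota 0 a.+1]%fset)
  (fun t => hat_extend a t rF).
exists (maxn b0 a.+1); split; first by rewrite leq_maxr.
move=> t b' ta ht nt; rewrite geq_max => /andP[? ?]; apply: (hb t) => //.
rewrite fpowersetE; apply/fsubsetP => n /ta na.
by rewrite in_fset mem_iota add0n ltnS.
Qed.

(** * Initial segments of a sequence that belong to the family *)

Definition seg (N : nat -> nat) (d : nat) : {fset nat} :=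
  [fset n in map N (iota 0 d)]%fset.

Lemma incr_le (N : nat -> nat) : (forall r, (N r < N r.+1)%N) ->
  forall r, (r <= N r)%N.
Proof. by move=> Ni; elim=> // r IH; exact: leq_ltn_trans IH (Ni r). Qed.

Lemma incr_homo (N : nat -> nat) : (forall r, (N r < N r.+1)%N) ->
  {homo N : i j / (i < j)%N}.
Proof. by move=> Ni; apply: homo_ltn => //; exact: ltn_trans. Qed.

Lemma incr_homo_leq (N : nat -> nat) : (forall r, (N r < N r.+1)%N) ->
  {homo N : i j / (i <= j)%N}.
Proof. by move=> Ni; apply: homo_leq => // [m n p|r]; [exact: leq_trans|exact: ltnW]. Qed.

Lemma elts_seg N d : (forall r, (N r < N r.+1)%N) ->
  elts (seg N d) = map N (iota 0 d).
Proof.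
move=> Ni; apply: elts_fset.
exact: (homo_sorted (incr_homo Ni)) (iota_ltn_sorted _ _).
Qed.

Lemma card_seg N d : (forall r, (N r < N r.+1)%N) -> #|` seg N d| = d.
Proof. by move=> Ni; rewrite -size_elts elts_seg// size_map size_iota. Qed.

Lemma nth_seg N d r : (forall r, (N r < N r.+1)%N) -> (r < d)%N ->
  nth 0%N (elts (seg N d)) r = N r.
Proof.
move=> Ni rd; rewrite elts_seg// (nth_map 0%N) ?size_iota//.
by rewrite nth_iota.
Qed.

Lemma mem_seg N d r : (r < d)%N -> N r \in seg N d.
Proof. by move=> rd; rewrite in_fset map_f// mem_iota. Qed.

Lemma mem_segP N d n : n \in seg N d -> exists2 r, (r < d)%N & n = N r.
Proof. by rewrite in_fset => /mapP[r]; rewrite mem_iota => /andP[_ rd] ->; exists r. Qed.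

Lemma segS N d : seg N d.+1 = (N d |` seg N d)%fset.
Proof.
apply/fsetP => n; rewrite in_fset1U !in_fset -[d.+1]addn1 iotaD map_cat mem_cat.
by rewrite /= inE add0n orbC.
Qed.

(** If every segment were in [hat F], compactness would put the limit of their characteristic
    functions there too; but this is the characteristic function of the infinite range of [N]. *)
Lemma seg_escapes F N : regular_thin F -> (forall r, (N r < N r.+1)%N) ->
  exists d, ~ hat F (seg N d).
Proof.
move=> [_ [_ _ compF] _] Ni; apply/not_existsP => allF.
have {}allF d : hat F (seg N d) by apply: contrapT; exact: allF.
pose chi (d : nat) : cantor_space := (fun n : nat => n \in seg N d) : nat -> bool.
(* Since [r <= N r], the first [n.+1] terms decide whether [n] is in the range of [N]. *)
pose lim : cantor_space := (fun n : nat => n \in seg N n.+1) : nat -> bool.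
have limE n d : (n < d)%N -> (n \in seg N d) = (n \in seg N n.+1).
  move=> nd; apply/idP/idP => /mem_segP[r rn E]; rewrite E mem_seg//.
    by rewrite -E ltnS E; exact: incr_le.
  by rewrite (leq_trans rn).
have chi_cvg : chi @ \oo --> lim.
  apply/pointwise_cvgP => n.
  apply: (@cvg_near_cst _ _ (lim n) (fun d => chi d n) \oo); exists n.+1 => //= d nd.
  by rewrite /chi /lim limE.
have [s _ lims] : [set c : cantor_space |
    exists2 s, hat F s & c = (fun n : nat => n \in s) :> (nat -> bool)] lim.
  apply: (closed_cvg _ compF _ _ chi_cvg).
  by apply: nearW => d /=; exists (seg N d).
have Ns r : N r \in s.
  have : lim (N r) by rewrite /lim mem_seg// ltnS incr_le.
  by rewrite lims.
pose m := \max_(i <- elts s) i.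
have : (N m.+1 <= m)%N.
  by have := @leq_bigmax_seq nat (elts s) xpredT id (N m.+1); apply; rewrite ?mem_elts.
by rewrite leqNgt (leq_trans _ (incr_le Ni _)).
Qed.

(** The first clause lets the empty set be extended by [N 0]; any [a] will do, as the empty set lies
    below every bound. *)
Definition good_row (F : set {fset nat}) (N : nat -> nat) : Prop :=
  (exists a, gap F a (N 0%N)) /\ forall r, gap F (N r) (N r.+1).

Lemma good_row_incr F N : good_row F N -> forall r, (N r < N r.+1)%N.
Proof. by move=> [_ gN] r; case: (gN r). Qed.

(** Take the last segment before the first one outside [hat F]. Were it not in [F], the gap after it
    would keep its successor in [hat F]. *)
Lemma good_row_seg F N : regular_thin F -> good_row F N ->
  exists2 d, (0 < d)%N & F (seg N d).
Proof.
move=> rF gN; have Ni := good_row_incr gN.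
have := seg_escapes rF Ni => -[d0 hd0].
pose P d := `[< ~ hat F (seg N d) >].
have /ex_minnP[d /asboolP hd dmin] : exists d, P d by exists d0; apply/asboolP.
have hat0 : hat F (seg N 0).
  case: rF => _ _ [s Fs _]; exists s => //.
  by rewrite /initial_segment elts_seg//= prefix0s.
(* The empty set is an initial segment of the nonempty member of [F], so thinness keeps it out of
   [F]. *)
have nF0 : ~ F (seg N 0).
  move=> F0; case: rF => thinF _ [s Fs sn0].
  have := thinF _ _ Fs F0; rewrite /initial_segment elts_seg//= prefix0s.
  move=> /(_ erefl) s0; move: sn0; rewrite -s0.
  by rewrite -cardfs_eq0 card_seg.
case: d hd dmin => [//|d] hd dmin.
have hatd : hat F (seg N d).
  by apply: contrapT => h; have := dmin d (asboolT h); rewrite ltnn.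
suff Fd : F (seg N d).
  by exists d => //; rewrite lt0n; apply/eqP => dz; apply: nF0; rewrite -dz.
apply: contrapT => nFd; apply: hd; rewrite segS.
case: d hatd nFd {dmin} => [|d] hatd nFd.
  by case: gN => -[a [_ ga]] _; apply: ga => // n /mem_segP[].
case: gN => _ /(_ d) [_ gd]; apply: gd => // n /mem_segP[r rd ->].
by apply: (incr_homo_leq Ni); rewrite -ltnS.
Qed.

(** * Plegma tuples and members of the family cut out by rows *)

(** This is [plegma] with tuples as total functions and elements counted from 0; the empty tuple is
    allowed. *)
Definition plegma_nat (k : nat) (s : nat -> {fset nat}) : Prop :=
  [/\ forall j, (j < k)%N -> s j != fset0,
      forall i j r, (i < j < k)%N -> (r < #|` s i|)%N -> (r < #|` s j|)%N ->
        (nth 0 (elts (s i)) r < nth 0 (elts (s j)) r)%N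
    & forall i j r, (i < k)%N -> (j < k)%N -> (r < #|` s i|)%N ->
        (r.+1 < #|` s j|)%N -> (nth 0 (elts (s i)) r < nth 0 (elts (s j)) r.+1)%N].

Lemma plegma_natP k s : plegma_nat k s <-> plegma (fun j : 'I_k => s j).
Proof.
split=> [[s0 s1 s2]|[s0 s1 s2]]; split.
- by move=> i; exact: s0.
- move=> i j [//|r] ij; rewrite leq_min => /and3P[_ ri rj].
  by apply: s1; rewrite ?ij ?ltn_ord.
- move=> i j [//|r]; rewrite leq_min => /and3P[_ ri rj].
  by apply: s2; rewrite ?ltn_ord// -ltn_predRL.
- by move=> j jk; exact: (s0 (Ordinal jk)).
- move=> i j r /andP[ij jk] ri rj; have ik := ltn_trans ij jk.
  by apply: (s1 (Ordinal ik) (Ordinal jk) r.+1); rewrite ?leq_min ?ri.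
- move=> i j r ik jk ri rj.
  by apply: (s2 (Ordinal ik) (Ordinal jk) r.+1); rewrite ?leq_min ?ri ?ltn_predRL.
Qed.

Lemma plegma_nat_cat_fun n m s t :
  plegma_nat n s -> plegma_nat m t ->
  (forall i j r, (i < n)%N -> (j < m)%N -> (r < #|` s i|)%N -> (r < #|` t j|)%N ->
    (nth 0 (elts (s i)) r < nth 0 (elts (t j)) r)%N) ->
  (forall i j r, (i < n)%N -> (j < m)%N -> (r.+1 < #|` s i|)%N -> (r < #|` t j|)%N ->
    (nth 0 (elts (t j)) r < nth 0 (elts (s i)) r.+1)%N) ->
  plegma_nat (n + m) (cat_fun n s t).
Proof.
move=> [s0 s1 s2] [t0 t1 t2] st ts; split.
- by move=> j jnm; rewrite /cat_fun; case: ltnP => jn; [exact: s0|apply: t0; lia].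
- move=> i j r /andP[ij jnm]; rewrite /cat_fun.
  have [iN|iN] := ltnP i n; have [jN|jN] := ltnP j n.
  + by apply: s1; rewrite ij.
  + by apply: st => //; lia.
  + lia.
  + by apply: t1; lia.
- move=> i j r ik jk; rewrite /cat_fun.
  have [iN|iN] := ltnP i n; have [jN|jN] := ltnP j n => ri rj.
  + exact: s2.
  (* [st] compares the elements number [r], and the next element of [t] is larger still. *)
  + have jm : (j - n < m)%N by lia.
    apply: ltn_trans (st i _ _ iN jm ri (ltnW rj)) _.
    by apply: elts_incr; rewrite ltnSn.
  + by apply: ts => //; lia.
  + by apply: t2 => //; lia.
Qed.

(** Through [front] an element of [F] is handled as an infinite row: plegma conditions are checked
    on rows, without knowing where [F] cuts them. The default [fset0] does not occur for good
    rows. *)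
Definition front (F : set {fset nat}) (N : nat -> nat) : {fset nat} :=
  xget fset0 [set s | F s /\ exists2 d, (0 < d)%N & s = seg N d].

Lemma frontP F N : regular_thin F -> good_row F N ->
  F (front F N) /\ exists2 d, (0 < d)%N & front F N = seg N d.
Proof.
move=> rF gN; have [d d0 Fd] := good_row_seg rF gN.
by rewrite /front; case: xgetP => [s _ //|/(_ (seg N d))[]]; split=> //; exists d.
Qed.

Lemma nth_front F N r : regular_thin F -> good_row F N ->
  (r < #|` front F N|)%N -> nth 0%N (elts (front F N)) r = N r.
Proof.
move=> rF gN; have [_ [d _ ->]] := frontP rF gN.
have Ni := good_row_incr gN.
by rewrite card_seg// => rd; exact: nth_seg.
Qed.

Lemma front_gt0 F N : regular_thin F -> good_row F N -> (0 < #|` front F N|)%N.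
Proof.
move=> rF gN; have [_ [d d0 ->]] := frontP rF gN.
by rewrite card_seg//; exact: good_row_incr gN.
Qed.

Lemma restrict_front F N M : regular_thin F -> good_row F N ->
  (forall r, M (N r)) -> restrict_family F M (front F N).
Proof.
move=> rF gN MN; have [? [d _ dE]] := frontP rF gN; split=> // n.
by rewrite dE => /mem_segP[r _ ->].
Qed.

Lemma plegma_nat_front F k (t : nat -> nat -> nat) : regular_thin F ->
  (forall j, (j < k)%N -> good_row F (t j)) ->
  (forall i j r, (i < j < k)%N -> (t i r < t j r)%N) ->
  (forall i j r, (i < k)%N -> (j < k)%N -> (t i r < t j r.+1)%N) ->
  plegma_nat k (fun j => front F (t j)).
Proof.
move=> rF gt t1 t2; split.
- by move=> j jk; rewrite -cardfs_eq0 -lt0n; apply: front_gt0 => //; exact: gt.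
- move=> i j r /andP[ij jk] ri rj; have ik := ltn_trans ij jk.
  by rewrite !nth_front//; [apply: t1; rewrite ij|exact: gt|exact: gt].
- move=> i j r ik jk ri rj.
  by rewrite !nth_front//; [exact: t2|exact: gt|exact: gt].
Qed.

(** * Sparse subsets of [M] *)

Lemma count_range (L : nat -> nat) r : (forall r, (L r < L r.+1)%N) ->
  count (fun n => `[< range L n >]) (iota 0 (L r).+1) = r.+1.
Proof.
move=> Li; rewrite -size_filter.
suff -> : [seq n <- iota 0 (L r).+1 | `[< range L n >]] = map L (iota 0 r.+1).
  by rewrite size_map size_iota.
apply: (irr_sorted_eq ltn_trans ltnn).
- by apply: sorted_filter (iota_ltn_sorted _ _); exact: ltn_trans.
- exact: (homo_sorted (incr_homo Li)) (iota_ltn_sorted _ _).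
- move=> n; rewrite mem_filter mem_iota leq0n add0n ltnS; apply/idP/idP.
    move=> /andP[/asboolP[q _ <-] qr]; apply: map_f.
    rewrite mem_iota add0n ltnS leq0n /= leqNgt; apply/negP => rq.
    by have := leq_ltn_trans qr (incr_homo Li rq); rewrite ltnn.
  move=> /mapP[q]; rewrite mem_iota add0n ltnS => /= qr ->.
  by apply/andP; split; [apply/asboolP; exists q|exact: incr_homo_leq].
Qed.

Lemma kth_set_range (L : nat -> nat) r : (forall r, (L r < L r.+1)%N) ->
  kth_set (range L) r.+1 = L r.
Proof.
move=> Li; rewrite /kth_set; case: xgetP => [m _ [[q _ <-]]|/(_ (L r))].
  by rewrite count_range// => -[->].
by case; split; [exists r|exact: count_range].
Qed.

Lemma infinite_nat_unbounded (A : set nat) :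
  infinite_set A <-> forall n, exists2 m, A m & (n < m)%N.
Proof.
split=> [Ainf n|Aunb Afin].
  apply: contrapT => h; apply: Ainf; apply: (sub_finite_set _ (finite_II n.+1)).
  move=> m Am /=; rewrite ltnNge; apply/negP => nm.
  by apply: h; exists m.
have /finite_seqP[s As] := Afin.
have [m + mlt] := Aunb (\max_(i <- s) i); rewrite As /= => ms.
by move: mlt; rewrite ltnNge (@leq_bigmax_seq _ s xpredT id).
Qed.

(** With [m i] rows at level [i], this is the number of rows of all levels up to [r], which have to
    share the gap after [L r]. *)
Definition budget (m : nat -> nat) (r : nat) : nat := \sum_(i < r.+1) m i.

Lemma budgetS m r : budget m r.+1 = (budget m r + m r.+1)%N.
Proof. by rewrite /budget big_ord_recr. Qed.

Lemma budget_ge m r : (m r <= budget m r)%N.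
Proof. by rewrite /budget big_ord_recr leq_addl. Qed.

Lemma budget_homo m : {homo budget m : r s / (r <= s)%N}.
Proof.
apply: homo_leq => // [a b c|r]; first exact: leq_trans.
by rewrite budgetS leq_addr.
Qed.

(** After [L r] there is room for [budget m r] further elements of [M], followed by a gap of [F]
    before [L r.+1]. Interleaved tuples are placed in this room. *)
Definition sparse_in (F : set {fset nat}) (M : set nat) (m nxt L : nat -> nat) : Prop :=
  [/\ forall n, M (nxt n) /\ (n < nxt n)%N,
      forall r, M (L r),
      exists a, gap F a (L 0%N)
    & forall r, gap F (iter (budget m r) nxt (L r)) (L r.+1)].

(** [theta r] stands for the threshold beyond which the norm estimates of level [r] hold. *)
Lemma sparse_exists F M (m theta : nat -> nat) : regular_thin F -> infinite_set M ->
  exists nxt L, sparse_in F M m nxt L /\ forall r, (theta r <= L r)%N.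
Proof.
move=> rF /infinite_nat_unbounded Munb.
have /choice[nxt nxtP] : forall n, exists b, M b /\ (n < b)%N.
  by move=> n; have [b] := Munb n; exists b.
have /choice[step stepP] : forall rn : nat * nat, exists b,
    [/\ M b, gap F rn.2 b & (theta rn.1 <= b)%N].
  move=> [r n]; have [b gb] := gap_exists n rF.
  have [c Mc bc] := Munb (maxn b (theta r)); exists c.
  move: bc; rewrite gtn_max => /andP[bc rc].
  by split => //; [apply: gap_weaken gb _ (ltnW bc)|exact: ltnW].
pose L := fix L r := match r with
  | 0 => step (0, 0)%N
  | q.+1 => step (q.+1, iter (budget m q) nxt (L q)) end.
exists nxt, L; split; last by case=> [|r]; [case: (stepP (0, 0)%N)|
  case: (stepP (r.+1, iter (budget m r) nxt (L r)))].
split => //.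
- by case=> [|r]; [case: (stepP (0, 0)%N)|
    case: (stepP (r.+1, iter (budget m r) nxt (L r)))].
- by exists 0%N; case: (stepP (0, 0)%N).
- by move=> r; case: (stepP (r.+1, iter (budget m r) nxt (L r))).
Qed.

(** * Tuples of different levels and their interleaving *)

(* [level_row r s j] is the [j]-th row of a tuple of level [r] whose [i]-th
   column lies in the gap of [M] following the element [L (s i)] of [L].  Rows of
   higher level are placed lower in each gap. *)
Definition block (nxt L : nat -> nat) (a i : nat) : nat := iter i.+1 nxt (L a).

Definition level_row (m nxt L : nat -> nat) (r : nat) (s : nat -> nat) (j i : nat) : nat :=
  block nxt L (s i) (budget m (s i) - budget m r + j).

Definition level_tuple (F : set {fset nat}) (m nxt L : nat -> nat) (r : nat)
    (s : nat -> nat) (j : nat) : {fset nat} :=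
  front F (level_row m nxt L r s j).

Section Levels.
Variables (F : set {fset nat}) (M : set nat) (m nxt L : nat -> nat).
Hypotheses (rF : regular_thin F) (spL : sparse_in F M m nxt L).

Local Notation D := (budget m).
Local Notation B := (block nxt L).
Local Notation tuple := (level_tuple F m nxt L).
Local Notation row := (level_row m nxt L).

Lemma iter_nxt_lt i j n : (i < j)%N -> (iter i nxt n < iter j nxt n)%N.
Proof.
case: spL => nP _ _ _; apply: (@incr_homo (fun i => iter i nxt n)) => r.
by case: (nP (iter r nxt n)).
Qed.

Lemma L_lt_block a i : (L a < B a i)%N.
Proof. exact: (@iter_nxt_lt 0). Qed.

Lemma block_lt a i j : (i < j)%N -> (B a i < B a j)%N.
Proof. by move=> ij; apply: iter_nxt_lt. Qed.

Lemma sparse_incr r : (L r < L r.+1)%N.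
Proof.
case: spL => _ _ _ /(_ r) [+ _]; apply: leq_ltn_trans.
by case: (D r) => // d; apply/ltnW/(@iter_nxt_lt 0).
Qed.

Lemma block_gap a b i : (a < b)%N -> (i < D a)%N -> gap F (B a i) (L b).
Proof.
move=> ab ia; case: spL => _ _ _ /(_ a) g; apply: gap_weaken g _ _.
  by move: ia; rewrite leq_eqVlt => /predU1P[<-//|ia]; exact/ltnW/iter_nxt_lt.
exact: (incr_homo_leq sparse_incr).
Qed.

Lemma L_gap a b : (a < b)%N -> gap F (L a) (L b).
Proof.
move=> ab; case: spL => _ _ _ /(_ a) g; apply: gap_weaken g _ _.
  by case: (D a) => // d; apply/ltnW/(@iter_nxt_lt 0).
exact: (incr_homo_leq sparse_incr).
Qed.

Lemma gap_below a : exists n, gap F n (L a).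
Proof.
have [n g] : exists n, gap F n (L 0%N) by case: spL.
by exists n; apply: gap_weaken g _ (incr_homo_leq sparse_incr _).
Qed.

Lemma block_lt_L a b i : (a < b)%N -> (i < D a)%N -> (B a i < L b)%N.
Proof. by move=> ab ia; case: (block_gap ab ia). Qed.

Lemma block_lt_block a b i j : (a < b)%N -> (i < D a)%N -> (B a i < B b j)%N.
Proof. by move=> ab ia; apply: ltn_trans (block_lt_L ab ia) (L_lt_block _ _). Qed.

Lemma level_pos r a j : (r <= a)%N -> (j < m r)%N -> (D a - D r + j < D a)%N.
Proof.
move=> ra jr; have := budget_ge m r; have := @budget_homo m _ _ ra; lia.
Qed.

(** [D a - D r.+1 + m r.+1 = D a - D r]: after [L a], level [r.+1] ends exactly where level [r]
    begins. *)
Lemma level_pos_drop r a j j' : (r < a)%N -> (j' < m r.+1)%N ->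
  (D a - D r.+1 + j' < D a - D r + j)%N.
Proof.
move=> ra jr; have := @budget_homo m _ _ ra; have := budgetS m r; lia.
Qed.

Section Fixed.
Variables (r : nat) (s : nat -> nat).
Hypotheses (s_incr : forall i, (s i < s i.+1)%N) (rs : (r <= s 0%N)%N).

Lemma level_le i : (r <= s i)%N.
Proof. by apply: leq_trans rs _; apply: (incr_homo_leq s_incr). Qed.

Lemma level_row_good j : (j < m r)%N -> good_row F (row r s j).
Proof.
move=> jr; split.
  by have [n g] := gap_below (s 0%N); exists n; apply: gap_weaken g _ (ltnW (L_lt_block _ _)).
move=> i; apply: gap_weaken (block_gap (s_incr i) (level_pos (level_le i) jr)) _ _ => //.
exact: ltnW (L_lt_block _ _).
Qed.

Lemma level_row_ltS i j j' : (j < m r)%N -> (row r s j i < row r s j' i.+1)%N.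
Proof.
by move=> jr; apply: block_lt_block => //; apply: level_pos => //; exact: level_le.
Qed.

Lemma plegma_level : plegma_nat (m r) (tuple r s).
Proof.
apply: plegma_nat_front => //.
- by move=> j; exact: level_row_good.
- by move=> i j k /andP[ij _]; apply: block_lt; rewrite ltn_add2l.
- by move=> i j k ir _; exact: level_row_ltS.
Qed.

Lemma level_tuple_restrict j : (j < m r)%N -> restrict_family F M (tuple r s j).
Proof.
move=> jr; apply: restrict_front => //; first exact: level_row_good.
by move=> i; case: spL => nP _ _ _; case: (nP (iter (D (s i) - D r + j) nxt (L (s i)))).
Qed.

Lemma level_tuple_nth j i : (j < m r)%N -> (i < #|` tuple r s j|)%N ->
  nth 0%N (elts (tuple r s j)) i = row r s j i.
Proof. by move=> jr; apply: nth_front => //; exact: level_row_good. Qed.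

Lemma level_tuple_first j : (j < m r)%N -> (L r <= nth 0 (elts (tuple r s j)) 0)%N.
Proof.
move=> jr; rewrite level_tuple_nth//.
  apply: leq_trans (ltnW (L_lt_block _ _)); exact: (incr_homo_leq sparse_incr).
by apply: front_gt0 => //; exact: level_row_good.
Qed.

End Fixed.

(** Column [k] of the second tuple shares a gap of [M] with column [k.+1] of the first and, being of
    higher level, lies below it there. *)
Lemma plegma_level_drop r s : (forall i, (s i < s i.+1)%N) -> (r <= s 0%N)%N ->
  plegma_nat (m r + m r.+1)
    (cat_fun (m r) (tuple r s) (tuple r.+1 (fun i => s i.+1))).
Proof.
move=> si rs; have si' i : (s i.+1 < s i.+2)%N by [].
have rs' : (r.+1 <= s 1%N)%N by apply: leq_ltn_trans rs (si 0%N).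
apply: plegma_nat_cat_fun; [exact: plegma_level|exact: plegma_level| |].
- move=> i j k ir jr ki kj; rewrite !level_tuple_nth//.
  by apply: block_lt_block => //; apply: level_pos => //; exact: level_le.
- move=> i j k ir jr ki kj; rewrite !level_tuple_nth//.
  by apply: block_lt; apply: level_pos_drop => //; exact: (level_le si').
Qed.

(** Equal columns share a gap of [M], so the tuple of higher level, which lies lower, comes
    first. *)
Lemma plegma_level_raise r s : (forall i, (s i < s i.+1)%N) -> (r < s 0%N)%N ->
  plegma_nat (m r.+1 + m r) (cat_fun (m r.+1) (tuple r.+1 s) (tuple r s)).
Proof.
move=> si rs; have rs' := ltnW rs.
apply: plegma_nat_cat_fun; [exact: plegma_level|exact: plegma_level| |].
- move=> i j k ir jr ki kj; rewrite !level_tuple_nth//.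
  by apply: block_lt; apply: level_pos_drop => //; exact: level_le.
- move=> i j k ir jr ki kj; rewrite !level_tuple_nth//.
  by apply: block_lt_block => //; apply: level_pos => //; exact: level_le.
Qed.

(* Each column of the appended tuple is put right after the last element of [L]
   used by that column of the given one. *)
Lemma plegma_level_append k t r : plegma_nat k.+1 t ->
  (forall j, (j < k.+1)%N -> restrict_family F (range L) (t j)) ->
  (L r <= nth 0 (elts (t 0%N)) 0)%N ->
  exists s, [/\ forall i, (s i < s i.+1)%N, (r <= s 0%N)%N,
    exists n c, forall i, s (n + i)%N = (c + i)%N &
    plegma_nat (k.+1 + m r) (cat_fun k.+1 t (tuple r s))].
Proof.
move=> tpl tL rt; have Linj : {mono L : a b / (a < b)%N}.
  move=> a b; apply/idP/idP; last exact: incr_homo sparse_incr _ _.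
  by apply: contraLR; rewrite -!leqNgt => /(incr_homo_leq sparse_incr).
have /choice[idx idxP] : forall n, exists a, range L n -> L a = n.
  move=> n; have [[a _ La]|nL] := pselect (range L n); first by exists a.
  by exists 0%N.
have tE j i : (j < k.+1)%N -> (i < #|` t j|)%N ->
    L (idx (nth 0%N (elts (t j)) i)) = nth 0%N (elts (t j)) i.
  move=> jk ij; apply: idxP; case: (tL j jk) => _; apply.
  by rewrite -mem_elts mem_nth// size_elts.
pose g i := \max_(j < k.+1) (if (i < #|` t j|)%N then idx (nth 0%N (elts (t j)) i) else 0%N).
have gE j i : (j < k.+1)%N -> (i < #|` t j|)%N -> (idx (nth 0%N (elts (t j)) i) <= g i)%N.
  move=> jk ij; have := @leq_bigmax _ (fun j : 'I_k.+1 =>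
    if (i < #|` t j|)%N then idx (nth 0%N (elts (t j)) i) else 0%N) (Ordinal jk).
  by rewrite /= ij.
have glt j i : (j < k.+1)%N -> (i.+1 < #|` t j|)%N ->
    (g i < idx (nth 0%N (elts (t j)) i.+1))%N.
  move=> jk ij; have ij' := ltnW ij.
  have lt_idx j' : (j' < k.+1)%N -> (i < #|` t j'|)%N ->
      (idx (nth 0 (elts (t j')) i) < idx (nth 0 (elts (t j)) i.+1))%N.
    by move=> j'k ij''; rewrite -Linj !tE//; case: tpl => _ _; apply.
  rewrite -(ltn_predK (lt_idx j jk ij')) ltnS; apply/bigmax_leqP => j' _.
  case: ifP => // ij''; rewrite -ltnS (ltn_predK (lt_idx j jk ij')).
  exact: lt_idx.
(* [g i] is the largest index in [L] of an element number [i] of the given sets; [s] is [g] forced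
   to increase strictly. It still stays below the indices of the elements number [i.+1], because
   those increase strictly too. *)
pose s := fix s i := match i with
  | 0 => g 0%N | i'.+1 => maxn (s i').+1 (g i'.+1) end.
have s_incr i : (s i < s i.+1)%N by rewrite /= leq_max leqnn.
have gs i : (g i <= s i)%N by case: i => [|i] //=; rewrite leq_maxr.
have st j i : (j < k.+1)%N -> (i.+1 < #|` t j|)%N ->
    (s i < idx (nth 0%N (elts (t j)) i.+1))%N.
  elim: i => [|i IH] jk ij; first exact: glt.
  rewrite /= gtn_max glt// andbT; apply: leq_ltn_trans (IH jk (ltnW ij)) _.
  by rewrite -Linj !tE// ?elts_incr ?ltnSn//; exact: ltnW.
have t_pos j : (j < k.+1)%N -> (0 < #|` t j|)%N.
  by move=> jk; rewrite cardfs_gt0; case: tpl => + _ _; apply.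
have rs : (r <= s 0%N)%N.
  apply: leq_trans (gE 0%N 0%N _ (t_pos 0%N _)) => //.
  by rewrite leqNgt -Linj tE ?t_pos// -leqNgt.
exists s; split => //.
  (* From the largest cardinality [n] on, [g] is 0 and [s] grows by exactly one. *)
  pose n := (\max_(j < k.+1) #|` t j|)%N.
  exists n, (s n); elim=> [|i IH]; first by rewrite !addn0.
  rewrite addnS /= IH [g _](_ : _ = 0%N) ?maxn0 ?addnS//.
  apply/eqP; rewrite -leqn0; apply/bigmax_leqP => j _; case: ifP => // nj.
  have := @leq_bigmax _ (fun j : 'I_k.+1 => #|` t j|) j.
  by rewrite -/n; lia.
apply: plegma_nat_cat_fun => //; first exact: plegma_level.
- move=> i j q ik jr qi qj; rewrite level_tuple_nth// -tE//.
  apply: leq_ltn_trans (L_lt_block _ _).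
  by apply: (incr_homo_leq sparse_incr); apply: leq_trans (gs q); exact: gE.
- move=> i j q ik jr qi qj; rewrite level_tuple_nth// -tE//.
  by apply: block_lt_L; [exact: st|apply: level_pos => //; exact: level_le].
Qed.

End Levels.

(** * Norm estimates on plegma tuples far out *)

Lemma seminorm0 (R : realType) (V : lmodType R) (p : V -> R) : seminorm p -> p 0 = 0.
Proof. by move=> [_ pZ]; rewrite -(scale0r (0 : V)) pZ normr0 mul0r. Qed.

(** Dividing by [C'] brings the coefficients into [[-1, 1]]; [l] is taken so large that [delta l],
    multiplied back by [C'], is at most [kappa]. *)
Lemma generates_close (R : realType) (X : normedModType R) F M (x : {fset nat} -> X)
    (V : lmodType R) (p : V -> R) (e : nat -> V) (Q : nat) (C kappa : R) :
  generates F M x p e -> 0 < kappa ->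
  exists n0, forall N s (b : nat -> R), (N <= Q)%N -> plegma_nat N s ->
    (forall j, (j < N)%N -> restrict_family F M (s j)) ->
    (forall j, (j < N)%N -> (n0 <= nth 0 (elts (s j)) 0)%N) ->
    (forall j, (j < N)%N -> `|b j| <= C) ->
    `| `|\sum_(j < N) b j *: x (s j)| - p (\sum_(j < N) b j *: e j) | <= kappa.
Proof.
move=> [sp _ [delta [_ delta0 gen]]] kappa0; pose C' := 1 + `|C|.
have C'0 : 0 < C' by rewrite ltr_pwDl.
have [l Ql dl] : exists2 l, (Q <= l)%N & delta l <= kappa / C'.
  have /cvgrPdist_le /(_ _ (divr_gt0 kappa0 C'0)) [l0 _ l0P] := delta0.
  exists (maxn Q l0); first exact: leq_maxl.
  have := l0P (maxn Q l0) (leq_maxr _ _); rewrite /= sub0r normrN.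
  by apply: le_trans; exact: ler_norm.
exists (kth_set M l) => N s b NQ spl sF sM bC.
(* [generates] speaks of nonempty tuples only; for [N = 0] both sums vanish. *)
case: N => [|k] in NQ spl sF sM bC *.
  by rewrite !big_ord0 normr0 (seminorm0 sp) subrr normr0 ltW.
have bE j : b j = C' * (b j / C') by rewrite mulrC divfK ?gt_eqF.
have -> : \sum_(j < k.+1) b j *: x (s j) = C' *: \sum_(j < k.+1) (b j / C') *: x (s j).
  by rewrite scaler_sumr; apply: eq_bigr => j _; rewrite scalerA -bE.
have -> : \sum_(j < k.+1) b j *: e j = C' *: \sum_(j < k.+1) (b j / C') *: e j.
  by rewrite scaler_sumr; apply: eq_bigr => j _; rewrite scalerA -bE.
case: (sp) => _ ->; rewrite normrZ -mulrBr normrM normr_id (gtr0_norm C'0).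
rewrite -ler_pdivlMl// mulrC; apply: le_trans dl.
apply: (gen k l (fun j => s j) (fun j => b j / C')); first exact: leq_trans Ql.
- exact/plegma_natP.
- by move=> j; exact: sF.
- exact: sM.
- move=> j; rewrite -ler_norml normrM normfV (gtr0_norm C'0) ler_pdivrMr// mul1r.
  by apply: le_trans (bC j (ltn_ord j)) _; rewrite /C'; have := ler_norm C; lra.
Qed.

Lemma generates_completion (R : realType) (X : normedModType R) F M (x : {fset nat} -> X)
    (V : lmodType R) (p : V -> R) (e : nat -> V)
    (E : completeNormedModType R) (iota : {linear V -> E}) :
  generates F M x p e -> completion_of_span p e iota -> ~ trivial_seq p e ->
  generates F M x (fun v : E => `|v|) (iota \o e).
Proof.
move=> [_ ind [delta [d0 d1 gen]]] comp ntr.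
split; [exact: seminorm_norm|exact: completion_lin_indep comp ntr ind|].
exists delta; split => // k l s a kl spl sF sM a1.
rewrite [X in _ - `|X|](_ : _ = iota (\sum_(j < k.+1) a j *: e j)).
  by case: comp => -> // *; [exact: gen|exact: span_seq_sum].
by rewrite linear_sum; apply: eq_bigr => j _; rewrite linearZ.
Qed.

(** On a plegma tuple admissible for both and far enough out, one and the same norm in [X] is within
    [eps / 2] of each seminorm. *)
Lemma generates_unique (R : realType) (X : normedModType R) F (x : {fset nat} -> X)
    (U V : lmodType R) (p : U -> R) (q : V -> R) (u : nat -> U) (v : nat -> V)
    M1 M2 : generates F M1 x p u -> generates F M2 x q v ->
  (forall N n0, exists s, [/\ plegma_nat N s,
     forall j, (j < N)%N -> restrict_family F M1 (s j),
     forall j, (j < N)%N -> restrict_family F M2 (s j) &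
     forall j, (j < N)%N -> (n0 <= nth 0 (elts (s j)) 0)%N]) ->
  isometric p q u v.
Proof.
move=> g1 g2 far n a; have [b ab] := ord_fun_extend 0 a.
under eq_bigr do rewrite -ab; under [in RHS]eq_bigr do rewrite -ab.
apply/eqP; rewrite -subr_eq0 -normr_le0; apply/ler_addgt0Pr => eps eps0; rewrite add0r.
have eps2 : 0 < eps / 2 by rewrite divr_gt0.
pose C := \sum_(j < n) `|b j|.
have [n1 close1] := generates_close n C g1 eps2.
have [n2 close2] := generates_close n C g2 eps2.
have [s [spl s1 s2 sn]] := far n (maxn n1 n2).
have bC j : (j < n)%N -> `|b j| <= C.
  move=> jn; rewrite /C (bigD1 (Ordinal jn))//= lerDl.
  by apply: sumr_ge0 => *; exact: normr_ge0.
have := close1 n s b (leqnn _) spl s1 _ bC.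
have := close2 n s b (leqnn _) spl s2 _ bC.
have sn1 j : (j < n)%N -> (n1 <= nth 0 (elts (s j)) 0)%N.
  by move=> /sn; rewrite geq_max => /andP[].
have sn2 j : (j < n)%N -> (n2 <= nth 0 (elts (s j)) 0)%N.
  by move=> /sn; rewrite geq_max => /andP[].
move=> /(_ sn2) + /(_ sn1); rewrite !ler_norml; lra.
Qed.

(** Any two elements of [range L] are separated by a gap of [F]. Dealing an increasing sequence of
    [A] out in turn to [N] rows therefore gives good rows, and these interleave. *)
Lemma sparse_far_plegma F M (m nxt L : nat -> nat) (A : set nat) :
  regular_thin F -> sparse_in F M m nxt L -> infinite_set A -> A `<=` range L ->
  forall N n0, exists s, [/\ plegma_nat N s,
     forall j, (j < N)%N -> restrict_family F A (s j) &
     forall j, (j < N)%N -> (n0 <= nth 0 (elts (s j)) 0)%N].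
Proof.
move=> rF spL /infinite_nat_unbounded Aunb AL N n0.
have /choice[nx nxP] : forall n, exists b, A b /\ (n < b)%N.
  by move=> n; have [b] := Aunb n; exists b.
pose z i := iter i.+1 nx n0.
have zi i : (z i < z i.+1)%N by case: (nxP (z i)).
have zA i : A (z i) by case: (nxP (iter i nx n0)).
have z_lt i j : (i < j)%N -> (z i < z j)%N by exact: incr_homo zi _ _.
have z_gap i j : (i < j)%N -> gap F (z i) (z j).
  move=> ij; have [a _ La] := AL _ (zA i); have [b _ Lb] := AL _ (zA j).
  rewrite -La -Lb; apply: (L_gap spL).
  rewrite ltnNge; apply/negP => /(incr_homo_leq (sparse_incr spL)).
  by rewrite La Lb leqNgt z_lt.
pose t j i := z (i * N + j)%N.
have t_good j : (j < N)%N -> good_row F (t j).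
  move=> jN; split; last by move=> i; apply: z_gap; rewrite mulSn; lia.
  by have [a _ La] := AL _ (zA j); rewrite /t mul0n -La; exact: gap_below spL a.
exists (fun j => front F (t j)); split.
- apply: plegma_nat_front => // i j r.
    by move=> /andP[ij _]; apply: z_lt; rewrite ltn_add2l.
  by move=> iN jN; apply: z_lt; rewrite mulSn; lia.
- by move=> j jN; apply: restrict_front => //; [exact: t_good|move=> r; exact: zA].
- move=> j jN; have gj := t_good _ jN; rewrite nth_front ?front_gt0//.
  have n0z : (n0 < z 0%N)%N by case: (nxP n0).
  apply: leq_trans (ltnW n0z) _; exact: (incr_homo_leq zi).
Qed.

Lemma sum_cat_fun_comp (R : pzRingType) (V : lmodType R) (T : Type) (f : T -> V)
    n m (b d : nat -> R) (s t : nat -> T) :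
  \sum_(j < n + m) cat_fun n b d j *: f (cat_fun n s t j) =
  \sum_(j < n) b j *: f (s j) + \sum_(j < m) d j *: f (t j).
Proof.
rewrite -(sum_cat_fun n m b d (f \o s) (f \o t)).
by apply: eq_bigr => j _; rewrite /cat_fun; case: ifP.
Qed.

Lemma sum_cat_fun_seq (R : pzRingType) (V : lmodType R) (u : nat -> V)
    n m (b d : nat -> R) :
  \sum_(j < n + m) cat_fun n b d j *: u j =
  \sum_(j < n) b j *: u j + \sum_(j < m) d j *: u (n + j)%N.
Proof.
rewrite -(sum_cat_fun_comp u n m b d id (addn n)).
apply: eq_bigr => j _; congr (_ *: u _); rewrite /cat_fun; case: ltnP => // nj.
by rewrite subnKC.
Qed.

Lemma cat_fun_ind (T : Type) (P : T -> Prop) n m (f g : nat -> T) :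
  (forall j, (j < n)%N -> P (f j)) -> (forall j, (j < m)%N -> P (g j)) ->
  forall j, (j < n + m)%N -> P (cat_fun n f g j).
Proof.
move=> Pf Pg j jnm; rewrite /cat_fun; case: ltnP => jn; first exact: Pf.
by apply: Pg; lia.
Qed.

(** * The limit vector and the translated subsequence *)

Section Limit.
Variables (R : realType) (X : completeNormedModType R) (E : normedModType R).
Variables (F : set {fset nat}) (M : set nat) (x : {fset nat} -> X).
Variables (u : nat -> E) (v : E).
Variables (m : nat -> nat) (lam : nat -> nat -> R) (nxt L : nat -> nat).

(** [tau r - tau r.+1 = 3 * kappa r], the cost of one comparison in [level_compare]; hence chains of
    comparisons telescope. *)
Let tau (r : nat) : R := 4^-1 ^+ r.
Let kappa (r : nat) : R := tau r.+1.
(** [Q r] covers levels [r] and [r.+1] together, as well as at most [r.+1] given sets followed by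
    level [r]. [C r] covers the weights of both levels, also those of level [r] multiplied by a sum
    of at most [r.+1] coefficients from [[-1, 1]]. *)
Let Q (r : nat) : nat := (r.+1 + m r + m r.+1)%N.
Let Lam (r : nat) : R := \sum_(j < m r) `|lam r j|.
Let C (r : nat) : R := r.+1%:R * (1 + Lam r + Lam r.+1).

Hypothesis rF : regular_thin F.
Hypothesis spL : sparse_in F M m nxt L.
Hypothesis weights : forall r k, increasing_below (m r) k ->
  `|\sum_(j < m r) lam r j *: u (k j) - v| <= kappa r.
Hypothesis close : forall r N t (b : nat -> R), (N <= Q r)%N -> plegma_nat N t ->
  (forall j, (j < N)%N -> restrict_family F M (t j)) ->
  (forall j, (j < N)%N -> (L r <= nth 0 (elts (t j)) 0)%N) ->
  (forall j, (j < N)%N -> `|b j| <= C r) ->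
  `| `|\sum_(j < N) b j *: x (t j)| - `|\sum_(j < N) b j *: u j| | <= kappa r.

Local Notation tuple := (level_tuple F m nxt L).

Let Y r s : X := \sum_(j < m r) lam r j *: x (tuple r s j).

Let Lam_ge0 r : 0 <= Lam r.
Proof. by apply: sumr_ge0 => *; exact: normr_ge0. Qed.

Let lam_le r j : (j < m r)%N -> `|lam r j| <= Lam r.
Proof.
move=> jm; rewrite /Lam (bigD1 (Ordinal jm))//= lerDl.
by apply: sumr_ge0 => *; exact: normr_ge0.
Qed.

Let C_ge r : [/\ 1 <= C r, r.+1%:R * Lam r <= C r, Lam r <= C r & Lam r.+1 <= C r].
Proof.
have h1 : 1 <= r.+1%:R :> R by rewrite ler1n.
have := Lam_ge0 r; have := Lam_ge0 r.+1; rewrite /C; split; nra.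
Qed.

Let tauS r : tau r = 4 * tau r.+1.
Proof. by rewrite /tau exprS mulrA divff ?mul1r. Qed.

Let tau_gt0 r : 0 < tau r. Proof. by rewrite exprn_gt0. Qed.

Let tau_small eps : 0 < eps -> exists r, forall c, (r <= c)%N -> tau c <= eps.
Proof.
move=> eps0; have /cvgrPdist_le /(_ eps eps0) [r _ rP] : (fun n => tau n) @ \oo --> (0 : R).
  by apply: cvg_expr; rewrite ger0_norm ?invf_lt1//; lra.
by exists r => c /rP /=; rewrite sub0r normrN gtr0_norm.
Qed.

(** In [E] each combination is within [kappa r] of [v], whatever its indices; passing from [X] to
    [E] by [close] costs a third [kappa r]. *)
Let level_compare r r1 r2 t1 t2 : (m r1 + m r2 <= Q r)%N ->
  kappa r1 <= kappa r -> kappa r2 <= kappa r -> Lam r1 <= C r -> Lam r2 <= C r ->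
  plegma_nat (m r1 + m r2) (cat_fun (m r1) t1 t2) ->
  (forall j, (j < m r1)%N -> restrict_family F M (t1 j)) ->
  (forall j, (j < m r2)%N -> restrict_family F M (t2 j)) ->
  (forall j, (j < m r1)%N -> (L r <= nth 0 (elts (t1 j)) 0)%N) ->
  (forall j, (j < m r2)%N -> (L r <= nth 0 (elts (t2 j)) 0)%N) ->
  `|\sum_(j < m r1) lam r1 j *: x (t1 j) - \sum_(j < m r2) lam r2 j *: x (t2 j)|
    <= tau r - tau r.+1.
Proof.
move=> mQ k1 k2 l1 l2 pl tM1 tM2 tL1 tL2.
have := @close r _ _ (cat_fun (m r1) (lam r1) (fun j => - lam r2 j)) mQ pl
  (cat_fun_ind (P := restrict_family F M) tM1 tM2)
  (cat_fun_ind (P := fun t => (L r <= nth 0 (elts t) 0)%N) tL1 tL2).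
rewrite sum_cat_fun_comp sum_cat_fun_seq.
under [X in `|_ + X| - _]eq_bigr do rewrite scaleNr.
under [X in _ - `|_ + X|]eq_bigr do rewrite scaleNr.
rewrite !sumrN => h.
have {}h : `| `|\sum_(j < m r1) lam r1 j *: x (t1 j) - \sum_(j < m r2) lam r2 j *: x (t2 j)|
  - `|\sum_(j < m r1) lam r1 j *: u j - \sum_(j < m r2) lam r2 j *: u (m r1 + j)%N| | <= kappa r.
  apply: h; apply: (cat_fun_ind (P := fun a => `|a| <= C r)) => j jr.
    exact: le_trans (lam_le jr) l1.
  by rewrite normrN; exact: le_trans (lam_le jr) l2.
have w1 : `|\sum_(j < m r1) lam r1 j *: u j - v| <= kappa r.
  by apply: le_trans k1; apply: (@weights r1 id) => i j /andP[].
have w2 : `|v - \sum_(j < m r2) lam r2 j *: u (m r1 + j)%N| <= kappa r.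
  by rewrite distrC; apply: le_trans k2; apply: weights; exact: increasing_below_addl.
have := ler_distD v (\sum_(j < m r1) lam r1 j *: u j)
  (\sum_(j < m r2) lam r2 j *: u (m r1 + j)%N).
move: h w1 w2; rewrite (tauS r) /kappa ler_norml; lra.
Qed.

Let kappaS_le r : kappa r.+1 <= kappa r.
Proof. by rewrite /kappa (tauS r.+1); have := tau_gt0 r.+2; lra. Qed.

Let step_drop r s : (forall i, (s i < s i.+1)%N) -> (r <= s 0%N)%N ->
  `|Y r s - Y r.+1 (fun i => s i.+1)| <= tau r - tau r.+1.
Proof.
move=> si rs; have rs' : (r.+1 <= s 1%N)%N by apply: leq_ltn_trans rs (si 0%N).
have si' i : (s i.+1 < s i.+2)%N by [].
have [_ _ l1 l2] := C_ge r.
apply: level_compare => //.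
- by rewrite /Q -addnA leq_addl.
- exact: (plegma_level_drop rF spL).
- by move=> j; exact: (level_tuple_restrict rF spL).
- by move=> j; exact: (level_tuple_restrict rF spL si').
- by move=> j; exact: (level_tuple_first rF spL).
- move=> j jm; apply: leq_trans (level_tuple_first rF spL si' rs' jm).
  exact/ltnW/(sparse_incr spL).
Qed.

Let step_raise r s : (forall i, (s i < s i.+1)%N) -> (r < s 0%N)%N ->
  `|Y r s - Y r.+1 s| <= tau r - tau r.+1.
Proof.
move=> si rs; have rs' := ltnW rs.
have [_ _ l1 l2] := C_ge r.
rewrite distrC; apply: level_compare => //.
- by rewrite /Q addnC -addnA leq_addl.
- exact: (plegma_level_raise rF spL).
- by move=> j; exact: (level_tuple_restrict rF spL).
- by move=> j; exact: (level_tuple_restrict rF spL).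
- move=> j jm; apply: leq_trans (level_tuple_first rF spL si rs jm).
  exact/ltnW/(sparse_incr spL).
- by move=> j; exact: (level_tuple_first rF spL).
Qed.

Let y r : X := Y r (addn r).

(* Drop the first column until [s] becomes an interval, and then raise the level
   until it equals the first element of that interval. *)
Let Y_near_y n r s c : (forall i, (s i < s i.+1)%N) -> (r <= s 0%N)%N ->
  (forall i, s (n + i)%N = (c + i)%N) -> `|Y r s - y c| <= tau r - tau c.
Proof.
elim: n r s => [|n IH] r s si rs sc.
  have {sc}sE : s = addn c by apply/funext => i; exact: sc.
  rewrite sE addn0 in si rs *.
  have [d cE] : exists d, c = (r + d)%N by exists (c - r)%N; rewrite subnKC.
  elim: d r rs cE => [|d IHd] r rs cE.
    by rewrite /y cE addn0 !subrr normr0.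
  have rc : (r < c)%N by lia.
  have := IHd r.+1 rc (etrans cE (addnS _ _)).
  have := @step_raise r (addn c) si; rewrite addn0 => /(_ rc).
  have := ler_distD (Y r.+1 (addn c)) (Y r (addn c)) (y c); lra.
have := @step_drop r s si rs.
have := IH r.+1 (fun i => s i.+1) (fun i => si i.+1) (leq_ltn_trans rs (si 0%N)) (fun i => sc i).
have := ler_distD (Y r.+1 (fun i => s i.+1)) (Y r s) (y c); lra.
Qed.

Lemma level_limit : exists x0 : X, `|x0| = `|v| /\
  forall r s, (forall i, (s i < s i.+1)%N) -> (r <= s 0%N)%N ->
    (exists n c, forall i, s (n + i)%N = (c + i)%N) -> `|Y r s - x0| <= tau r.
Proof.
have addr_incr r i : (r + i < r + i.+1)%N by rewrite addnS.
have y_cauchy r c : (r <= c)%N -> `|y r - y c| <= tau r.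
  move=> rc; have : `|y r - y c| <= tau r - tau c.
    apply: (@Y_near_y (c - r)) => [i||i] //; first by rewrite addn0.
    by rewrite addnA subnKC.
  by have := tau_gt0 c; lra.
have /cvg_ex[x0 yx0] : cvg (y @ \oo).
  apply/cauchy_cvgP/cauchy_exP => eps eps0.
  have [r rP] := tau_small (divr_gt0 eps0 (ltr0n R 2)).
  exists (y r); exists r => // c rc; rewrite -ball_normE /=.
  apply: le_lt_trans (y_cauchy _ _ rc) _.
  by have := rP r (leqnn r); lra.
have y_lim eps : 0 < eps -> exists r, forall c, (r <= c)%N -> `|y c - x0| <= eps.
  move=> eps0; move/cvgrPdist_le : yx0 => /(_ eps eps0)[r _ rP].
  by exists r => c /rP /=; rewrite distrC.
exists x0; split.
  (* [y r] is near [x0], its norm is near that of the weighted combination of [u], and this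
     combination is near [v]; each step costs at most [eps / 3]. *)
  apply/eqP; rewrite -subr_eq0 -normr_le0; apply/ler_addgt0Pr => eps eps0; rewrite add0r.
  have eps3 : 0 < eps / 3 by rewrite divr_gt0.
  have [r1 r1P] := y_lim _ eps3; have [r2 r2P] := tau_small eps3.
  pose r := maxn r1 r2.
  have y1 := r1P r (leq_maxl _ _).
  have kr : kappa r <= eps / 3 by apply: r2P; apply: leqW; exact: leq_maxr.
  have r0 : (r <= r + 0)%N by rewrite addn0.
  have [_ _ l1 _] := C_ge r.
  have : `| `|y r| - `|\sum_(j < m r) lam r j *: u j| | <= kappa r.
    apply: close; first by rewrite /Q -addnA addnCA leq_addr.
    - exact: (plegma_level rF spL).
    - by move=> j; exact: (level_tuple_restrict rF spL).
    - by move=> j; exact: (level_tuple_first rF spL).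
    - by move=> j /lam_le h; exact: le_trans h l1.
  have : `|\sum_(j < m r) lam r j *: u j - v| <= kappa r.
    by apply: (@weights r id) => i j /andP[].
  have := ler_dist_dist (y r) x0.
  have := ler_dist_dist (\sum_(j < m r) lam r j *: u j) v.
  rewrite !ler_norml; lra.
move=> r s si rs [n [c sc]]; apply/ler_addgt0Pr => eps eps0.
have [c' cP] := y_lim _ eps0.
(* The tail of [s] that is an interval may be cut later, so that it starts at a [c2] with [y c2]
   close to [x0]. *)
pose c2 := maxn c c'.
have sc2 i : s (n + (c2 - c) + i)%N = (c2 + i)%N.
  by rewrite -addnA sc addnA subnKC// leq_maxl.
have := Y_near_y si rs sc2; have := cP c2 (leq_maxr _ _).
have := tau_gt0 c2; have := ler_distD (y c2) (Y r s) x0; lra.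
Qed.

Lemma generates_sub (x0 : X) :
  (forall r s, (forall i, (s i < s i.+1)%N) -> (r <= s 0%N)%N ->
    (exists n c, forall i, s (n + i)%N = (c + i)%N) -> `|Y r s - x0| <= tau r) ->
  lin_indep (fun n => u n - v) -> range L `<=` M ->
  generates F (range L) (fun t => x t - x0) (fun w : E => `|w|) (fun n => u n - v).
Proof.
move=> x0P ind LM; split => //; first exact: seminorm_norm.
(* For [l = r.+1] the three errors add up to [r.+1%:R * tau r + kappa r + r.+1%:R * kappa r]. As
   [tau r] is the square of [2^-1 ^+ r] and [r.+1%:R * 2^-1 ^+ r <= 1], this is at most
   [2 * 2^-1 ^+ r]. *)
exists (fun l => 4 * 2^-1 ^+ l); split.
- by move=> l; rewrite mulr_gt0// exprn_gt0.
- rewrite -[X in _ --> X](mulr0 4); apply: cvgMr; apply: cvg_expr.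
  by rewrite ger0_norm ?invf_lt1//; lra.
(* [k.+1 <= l] excludes [l = 0]; for [l = r.+1] the element number [l] of [range L], counted from 1,
   is [L r], so level [r] is the one to append. *)
move=> k [//|r] t0 a kr; have [t tE] := ord_fun_extend fset0 t0.
have {tE}-> : t0 = (fun j : 'I_k.+1 => t j) by apply/funext => j; rewrite tE.
have [b bE] := ord_fun_extend 0 a.
have {bE}-> : a = (fun j : 'I_k.+1 => b j) by apply/funext => j; rewrite bE.
move=> /plegma_natP tpl tL; rewrite (kth_set_range _ (sparse_incr spL)) => rt b1.
have {}b1 j : (j < k.+1)%N -> `|b j| <= 1.
  by move=> jk; have := b1 (Ordinal jk); rewrite ler_norml.
have {}tL j : (j < k.+1)%N -> restrict_family F (range L) (t j).
  by move=> jk; exact: (tL (Ordinal jk)).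
have [s [si rs sc apl]] := plegma_level_append rF spL tpl tL rt.
pose A := \sum_(j < k.+1) b j.
have A_le : `|A| <= r.+1%:R.
  apply: le_trans (ler_norm_sum _ _ _) _.
  apply: (@le_trans _ _ (\sum_(j < k.+1) 1)).
    by apply: ler_sum => j _; exact: b1.
  by rewrite sumr_const card_ord ler_nat.
under eq_bigr do rewrite scalerBr; under [X in _ - `|X|]eq_bigr do rewrite scalerBr.
rewrite !sumrB -!scaler_suml -/A.
set P := \sum_(j < k.+1) b j *: x (t j); set U := \sum_(j < k.+1) b j *: u j.
pose z := \sum_(j < m r) lam r j *: u (k.+1 + j)%N.
have zv : `|z - v| <= kappa r by apply: weights; exact: increasing_below_addl.
have yx := x0P r s si rs sc.
have [C1 C2 _ _] := C_ge r.
have PU : `| `|P - A *: Y r s| - `|U - A *: z| | <= kappa r.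
  have tL0 j : (j < k.+1)%N -> (L r <= nth 0 (elts (t j)) 0)%N.
    move=> jk; apply: leq_trans rt _; case: j jk => // j jk.
    apply: ltnW; case: tpl => t0' + _; apply; rewrite ?jk// cardfs_gt0; exact: t0'.
  (* With the weights multiplied by [- A], the concatenated sum is [P - A *: Y r s] in [X] and
     [U - A *: z] in [E]. *)
  have := @close r _ _ (cat_fun k.+1 b (fun j => - (A * lam r j))) _ apl
    (cat_fun_ind (P := restrict_family F M) _ (level_tuple_restrict rF spL si rs))
    (cat_fun_ind (P := fun t => (L r <= nth 0 (elts t) 0)%N) tL0
       (level_tuple_first rF spL si rs)).
  rewrite sum_cat_fun_comp sum_cat_fun_seq.
  under [X in `|_ + X| - _]eq_bigr do rewrite scaleNr -scalerA.
  under [X in _ - `|_ + X|]eq_bigr do rewrite scaleNr -scalerA.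
  rewrite !sumrN -!scaler_sumr; apply.
  - by rewrite /Q; lia.
  - by move=> j /tL [Ft tLj]; split=> // n /tLj; exact: LM.
  - apply: (cat_fun_ind (P := fun a => `|a| <= C r)) => j jr.
      exact: le_trans (b1 j jr) C1.
    rewrite normrN normrM; apply: le_trans C2.
    by apply: ler_pM => //; exact: lam_le.
have h1 : `| `|P - A *: x0| - `|P - A *: Y r s| | <= r.+1%:R * tau r.
  apply: le_trans (ler_dist_dist _ _) _.
  rewrite opprB addrC addrA subrK -scalerBr normrZ.
  by apply: ler_pM.
have h2 : `| `|U - A *: z| - `|U - A *: v| | <= r.+1%:R * kappa r.
  apply: le_trans (ler_dist_dist _ _) _.
  rewrite opprB addrC addrA subrK -scalerBr normrZ distrC.
  by apply: ler_pM.
have bound : r.+1%:R * tau r + kappa r + r.+1%:R * kappa r <= 4 * 2^-1 ^+ r.+1.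
  have r2 : r.+1%:R * 2^-1 ^+ r <= 1 :> R.
    rewrite exprVn ler_pdivrMr ?exprn_gt0// mul1r -natrX ler_nat.
    exact: ltn_expl.
  have tauE : tau r = 2^-1 ^+ r * 2^-1 ^+ r.
    by rewrite /tau -exprMn; congr (_ ^+ _); field.
  have p0 : 0 < 2^-1 ^+ r :> R by rewrite exprn_gt0.
  have n1 : 1 <= r.+1%:R :> R by rewrite ler1n.
  have := tauS r; rewrite /kappa exprS tauE.
  move: (2^-1 ^+ r) r2 p0 => p r2 p0 tE.
  have : r.+1%:R * (p * p) <= p by rewrite mulrA; nra.
  nra.
move: PU h1 h2 bound; rewrite !ler_norml; lra.
Qed.

End Limit.

Theorem theorem0p12 (R : realType) (X : completeNormedModType R)
    (F : set {fset nat}) (M : set nat) (x_ : {fset nat} -> X)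
    (V : lmodType R) (p : V -> R) (e_ : nat -> V)
    (E : completeNormedModType R) (iota : {linear V -> E})
    (e' : nat -> E) (e : E)
    (F_on_N : family_on_N F) (F_regular_thin : regular_thin F)
    (M_sub_N : M `<=` posN) (M_infinite : infinite_set M)
    (x_generates_e : generates F M x_ p e_)
    (E_completion : completion_of_span p e_ iota)
    (e_singular : singular_spreading p e_ iota)
    (e_decomposition : natural_decomposition (iota \o e_) e' e) :
  exists (x : X) (L : set nat),
    [/\ L `<=` M, infinite_set L, `|x| = `|e|,
        generates F L (fun s => x_ s - x) (fun v : E => `|v|) e' &
        forall (L' : set nat) (W : lmodType R) (q : W -> R) (w : nat -> W),
          L' `<=` L -> infinite_set L' ->
          generates F L' (fun s => x_ s - x) q w ->
          isometric q (fun v : E => `|v|) w e'].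
Proof.
have [spr ntr _] := e_singular; have [uv _ e'E] := e_decomposition.
have gen := generates_completion x_generates_e E_completion ntr.
have {}spr := completion_spreading_norm E_completion spr.
have {e'E} e'E : e' = (fun n => (iota \o e_) n - e) by apply/funext.
set u := iota \o e_ in gen spr uv e'E.
have ind : lin_indep e' by case: gen => _ ind _; rewrite e'E; exact: weakly_null_part_lin_indep.
have tau0 r : 0 < 4^-1 ^+ r.+1 :> R by rewrite exprn_gt0.
have /choice[w wP] : forall r, exists mb : nat * (nat -> R),
    forall k, increasing_below mb.1 k ->
    `|\sum_(j < mb.1) mb.2 j *: u (k j) - e| <= 4^-1 ^+ r.+1.
  move=> r; have [m [b mbP]] := weak_limit_weights spr uv (tau0 r).
  by exists (m, b).
pose m r := (w r).1; pose lam r := (w r).2.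
pose Lam r := \sum_(j < m r) `|lam r j|.
(* The length and coefficient bounds of level [r] involve the weights of levels [r] and [r.+1];
   hence all weights are fixed first, then the thresholds, and [L] last. *)
have /choice[theta thetaP] := fun r => generates_close (r.+1 + m r + m r.+1)
  (r.+1%:R * (1 + Lam r + Lam r.+1)) gen (tau0 r).
have [nxt [L [spL thL]]] := sparse_exists m theta F_regular_thin M_infinite.
have close r N t (b : nat -> R) : (N <= r.+1 + m r + m r.+1)%N -> plegma_nat N t ->
    (forall j, (j < N)%N -> restrict_family F M (t j)) ->
    (forall j, (j < N)%N -> (L r <= nth 0 (elts (t j)) 0)%N) ->
    (forall j, (j < N)%N -> `|b j| <= r.+1%:R * (1 + Lam r + Lam r.+1)) ->
    `| `|\sum_(j < N) b j *: x_ (t j)| - `|\sum_(j < N) b j *: u j| | <= 4^-1 ^+ r.+1.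
  move=> NQ pl tM tL; apply: thetaP => // j jN.
  exact: leq_trans (thL r) (tL j jN).
have [x [xe xP]] := level_limit F_regular_thin spL wP close.
have LM : range L `<=` M by case: spL => _ ML _ _ _ [r _ <-].
have gen_L : generates F (range L) (fun s => x_ s - x) (fun v : E => `|v|) e'.
  rewrite e'E; apply: (generates_sub F_regular_thin spL wP close xP) => //.
  by rewrite -e'E.
exists x, (range L); split => //.
  apply/infinite_nat_unbounded => n; exists (L n.+1); first by exists n.+1.
  exact: leq_ltn_trans (incr_le (sparse_incr spL) n) (sparse_incr spL n).
(* Far plegma tuples inside [L'] are also admissible for [range L], so both spreading models are
   read off the same vectors. *)
move=> L' W q v L'L L'inf gen_L'; apply: (generates_unique gen_L' gen_L) => N n0.
have [s [pl sL' sn]] := sparse_far_plegma F_regular_thin spL L'inf L'L N n0.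
by exists s; split => // j /sL'[Fs sj]; split => // n /sj; exact: L'L.
Qed.
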